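(* Let $\sigma>0$ and $n\in\mathbb{Z}\setminus\{0\}$ be fixed, and let $\mathbf{A}_n$ be the self-adjoint operator on $\mathscr{H}_n$ defined in the context. Then the sequence $\{\lambda_{n,k}\}_{k=0}^{+\infty}$, with $\lambda_{n,k}<0$, of eigenvalues of $\mathbf{A}_n$ reads as follows: $$\{\lambda_{n,k}\}_{k=0}^{+\infty}=\Big\{-\Big(\frac{(k+1)\pi}{2}+\frac\pi4-\varepsilon_{k+1}\Big)^2-n^2\Big\}_{k=0}^{+\infty}\qquad\text{if }\sigma>2,$$ for some $\varepsilon_k\in(0,\frac\pi4)$, and $$\{\lambda_{n,k}\}_{k=0}^{+\infty}=\Big\{-\Big(\frac{k\pi}{2}+\frac\pi4-\varepsilon_k\Big)^2-n^2\Big\}_{k=1}^{+\infty}\ \cup\ \begin{cases}\{\nu_0^2-n^2\}&\text{if }\sigma<2,\\ \{-n^2\}&\text{if }\sigma=2,\end{cases}$$ otherwise, for some $\nu_0\in(0,\frac1\sigma)$ independent of $k$ (the second set in the union being indexed by $k=0$; $\nu_0$ might depend on $n$). Furthermore, the following properties hold. (1) The sequence $\{\lambda_{n,k}\}_{k=0}^{+\infty}$ is separated uniformly with respect to $n\in\mathbb{Z}\setminus\{0\}$, in the sense that $\inf_{k\geqslant0}|\lambda_{n,k+1}-\lambda_{n,k}|>\gamma$ holds for some $\gamma>0$ independent of $n$. (2) Moreover, $-\lambda_{n,k}=rk^2+n^2+\mathcal{O}(k)$ as $k\to+\infty$, for some $r>0$ independent of $n$ and $\sigma$. (3) Suppose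 that $(c,d)\subset(-1,1)$ is fixed, with $c<d$. Then there exists some constant $C=C(\sigma,c-d)>0$ such that for any $n\in\mathbb{Z}\setminus\{0\}$ and $k\geqslant0$, the normalized eigenfunctions $\Phi_{n,k}:=\big(\varphi_{n,k},\,-\frac{1}{\sigma n^2}\varphi_{n,k}(1)\big)$ of $\mathbf{A}_n$ are such that $\|\varphi_{n,k}\|_{L^2(c,d)}\geqslant C$ holds.
   Context: For $n\in\mathbb{Z}\setminus\{0\}$, $\mathscr{H}_n=L^2(-1,1)\times\mathbb{R}$ with inner product $\langle(f_1,g_1),(f_2,g_2)\rangle_{\mathscr{H}_n}=\langle f_1,f_2\rangle_{L^2(-1,1)}+\sigma n^2g_1g_2$, and $\mathbf{A}_n(y,h)=(\partial_{x_2}^2y-n^2y,\ \partial_{x_2}y(1))$ with domain $\mathfrak{D}(\mathbf{A}_n)=\{(y,h)\in H^2(-1,1)\times\mathbb{R}:y(-1)=0,\ y(1)=-\sigma n^2h\}$. This operator is self-adjoint with compact resolvent and negative eigenvalues, listed as a decreasing sequence; $\Phi_{n,k}$ is an eigenfunction associated with $\lambda_{n,k}$. ''Normalized'' means $\|\Phi_{n,k}\|_{\mathscr{H}_n}=1$.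
   Formalization: For σ>2 the printed list omits the largest eigenvalue (e.g. −π²/64−1 for n=1, σ=π/8+8/π); the formal statement has λ_{n,k} = −(kπ/2+π/4−ε_k)²−n² for all k≥0, in place of (k+1)π/2 and ε_{k+1}. *)

(* Defs.v *)
From HB Require Import structures.
From mathcomp Require Import all_boot all_order all_algebra.
From mathcomp Require Import all_classical all_reals all_analysis.

Set Implicit Arguments.
Unset Strict Implicit.
Unset Printing Implicit Defensive.

Import Order.TTheory GRing.Theory Num.Theory.
Import numFieldNormedType.Exports.

Local Open Scope classical_set_scope.
Local Open Scope ring_scope.

Section OpenInterval.
Context {R : realType}.
Implicit Types (f g y dy psi : R -> R).

Local Notation mu := (@lebesgue_measure R).
Local Notation I := (`]-1, 1[%classic : set R).

(* Elements of L^2(-1,1) are represented by functions on R whose values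
   outside (-1,1) are irrelevant; equality in L^2 is [ae_eq_on]. *)
Definition L2 f : Prop :=
  measurable_fun I f /\ mu.-integrable I (fun x => (f x ^+ 2)%:E).

Definition ae_eq_on f g : Prop := {ae mu, forall x, I x -> f x = g x}.

Definition L2dot f g : R := \int[mu]_(x in I) (f x * g x).

Definition L2norm_on (c d : R) f : R :=
  Num.sqrt (\int[mu]_(x in `]c, d[) (f x ^+ 2)).

Definition test_function psi : Prop :=
  [/\ forall x, derivable psi x 1,
      continuous (derive1 psi)
    & closure [set x | psi x != 0] `<=` I].

(* Test functions in C^1_c, as in Brezis, "Functional Analysis, Sobolev Spaces
   and Partial Differential Equations", Section 8.2; by density this is the
   same notion as with C^oo_c. *)
Definition weak_derivative y dy : Prop :=
  forall psi, test_function psi ->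
    \int[mu]_(x in I) (y x * derive1 psi x) = - (\int[mu]_(x in I) (dy x * psi x)).

(* y belongs to H^2(-1,1), with y' = dy and y'' = d2y.  Since H^2(-1,1) embeds
   in C^1([-1,1]), y and dy are taken to be the continuous representatives, so
   that their values at -1 and 1 are the traces. *)
Definition H2 y dy d2y : Prop :=
  [/\ [/\ L2 y, L2 dy & L2 d2y],
      weak_derivative y dy,
      weak_derivative dy d2y,
      {within `[-1, 1], continuous y}
    & {within `[-1, 1], continuous dy}].

End OpenInterval.

Section Operator.
Context {R : realType}.
Variables (sigma : R) (n : int).
Implicit Types (Y Z : (R -> R) * R) (z : R).

Definition Hdot Y Z : R :=
  L2dot Y.1 Z.1 + sigma * n%:~R ^+ 2 * Y.2 * Z.2.

Definition Hnorm Y : R := Num.sqrt (Hdot Y Y).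

(* The graph of A_n: Y belongs to the domain, and A_n Y = Z. *)
Definition A_graph Y Z : Prop :=
  exists dy d2y : R -> R,
    [/\ H2 Y.1 dy d2y,
        Y.1 (-1) = 0,
        Y.1 1 = - sigma * n%:~R ^+ 2 * Y.2,
        ae_eq_on Z.1 (fun x => d2y x - n%:~R ^+ 2 * Y.1 x)
      & Z.2 = dy 1].

Definition eigenfunction z Y : Prop :=
  Hnorm Y != 0 /\ A_graph Y (fun x => z * Y.1 x, z * Y.2).

Definition eigenvalues : set R := [set z | exists Y, eigenfunction z Y].

Definition eigenvalue_sequence (lambda : nat -> R) : Prop :=
  decreasing_seq lambda /\ range lambda = eigenvalues.

End Operator.

(* Main.v *)
Require Import Defs.
From HB Require Import structures.
From mathcomp Require Import all_boot all_order all_algebra.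
From mathcomp Require Import all_classical all_reals all_analysis.
From mathcomp Require Import measurable_realfun.
From mathcomp Require Import ring lra.
Import Order.TTheory GRing.Theory Num.Theory.
Import numFieldNormedType.Exports.
Local Open Scope classical_set_scope.
Local Open Scope ring_scope.

(** An eigenfunction is a weak, hence (du Bois-Reymond) classical, solution of
    y'' = m y with m = z + n^2 and y(-1) = 0, so it is a multiple of
    sin(w(x+1)), x+1 or sinh(v(x+1)) according to the sign of m. The boundary
    conditions at 1 then become sigma n^2 y'(1) + z y(1) = 0, that is
    tan(2w)/w = sigma n^2/(n^2 + w^2) when m = -w^2, sigma = 2 when m = 0, and
    tanh(2v)/v = sigma n^2/(n^2 - v^2) when m = v^2. As tan(u)/u increases on
    each branch of tan and tanh(u)/u decreases, there is exactly one root w in each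
    (k pi/2, k pi/2 + pi/4) with k > 0, one more root (k = 0) if sigma > 2, and one
    root v if sigma < 2; this gives the spectrum, its gap and its asymptotics.
    For the lower bound on (c, d), the normalization bounds the amplitude of the
    eigenfunction from below; when k > 0 one has w >= 1 and the integral of
    sin(w(x+1))^2 is explicit, while the profile for k = 0 dominates (x+1)/2. *)

(** * Integrals of continuous functions *)

(** The sign of m is unknown beforehand, so the boundary value problem is solved once for an
    abstract pair (S, C) with S'' = m S and C = S'; the three explicit profiles enter only
    afterwards. In regularity, y'' is a mere L^2 class, and test functions are only C^1, so
    quadratic splines are admissible and everything reduces to integrals of continuous functions.
    Eigenvalues are labelled by the branch of tan on which their root lies. The distance between
    consecutive branches then yields the ordering of the spectrum and the uniform gap together.
    Uniformity in n has three sources: n^2 >= 1 in the normalization, the bound v < 1 / sigma on the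
    hyperbolic root, and w >= 1 for k > 0. For k = 0 the oscillating frequency only lies in (0, pi /
    4), hence the comparison with (x + 1) / 2 instead of an explicit integral. *)

Section IntegralCalculus.
Set Implicit Arguments.
Unset Strict Implicit.
Context {R : realType}.
Implicit Types (f g h F : R -> R) (a b c x : R).
Local Notation mu := (@lebesgue_measure R).

Lemma integrable_oo_continuous f a b :
  {within `[a, b], continuous f} -> mu.-integrable `]a, b[ (EFin \o f).
Proof.
move=> cf; apply: (@integrableS _ _ _ mu `[a, b]) => //.
  exact: subset_itv_oo_cc.
by apply: continuous_compact_integrable => //; exact: segment_compact.
Qed.

Lemma integrable_cc_continuous f a b :
  {within `[a, b], continuous f} -> mu.-integrable `[a, b] (EFin \o f).
Proof.
by move=> cf; apply: continuous_compact_integrable => //; exact: segment_compact.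
Qed.

Lemma Rintegral_oo_cc f a b : a < b ->
  {within `[a, b], continuous f} ->
  \int[mu]_(x in `]a, b[) f x = \int[mu]_(x in `[a, b]) f x.
Proof.
move=> ab cf; have fi := integrable_cc_continuous cf.
rewrite Rintegral_itv_bndo_bndc; last exact: integrable_oo_continuous.
rewrite Rintegral_itv_obnd_cbnd//.
by apply: (integrableS _ _ _ fi) => //; exact: subset_itv_oc_cc.
Qed.

Lemma Rintegral_FTC2 f F a b : a < b ->
  {within `[a, b], continuous f} -> {within `[a, b], continuous F} ->
  {in `]a, b[, forall x, is_derive x 1 F (f x)} ->
  \int[mu]_(x in `]a, b[) f x = F b - F a.
Proof.
move=> ab cf cF dF; rewrite Rintegral_oo_cc// /Rintegral.
rewrite (@continuous_FTC2 _ f F)//.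
  have [_ Fa Fb] := (continuous_within_itvP F ab).1 cF.
  by split => // x xab; apply: ex_derive; exact: dF.
by move=> x xab; rewrite derive1E; apply: derive_val; exact: dF.
Qed.

Lemma continuous_primitive f a b : a < b -> {within `[a, b], continuous f} ->
  exists2 F : R -> R, {within `[a, b], continuous F} &
    {in `]a, b[, forall x, is_derive x 1 F (f x)}.
Proof.
move=> ab cf; have fi := integrable_cc_continuous cf.
exists (fun x => \int[mu]_(t in `[a, x]) f t).
  by apply: parameterized_integral_continuous => //; exact: ltW.
move=> x; rewrite in_itv /= => /andP[ax xb].
have cfx : {for x, continuous f}.
  have /(continuous_within_itvP f ab)[+ _ _] := cf; apply.
  by rewrite in_itv/= ax.
have [dF <-] := continuous_FTC1_closed xb fi ax cfx.
by rewrite derive1E; exact: derivableP.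
Qed.

Lemma within_continuousD (A : set R) f g :
  {within A, continuous f} -> {within A, continuous g} ->
  {within A, continuous (fun x => f x + g x)}.
Proof. by move=> cf cg x; apply: continuousD; [exact: cf|exact: cg]. Qed.

Lemma within_continuousB (A : set R) f g :
  {within A, continuous f} -> {within A, continuous g} ->
  {within A, continuous (fun x => f x - g x)}.
Proof. by move=> cf cg x; apply: continuousB; [exact: cf|exact: cg]. Qed.

Lemma within_continuousM (A : set R) f g :
  {within A, continuous f} -> {within A, continuous g} ->
  {within A, continuous (fun x => f x * g x)}.
Proof. by move=> cf cg x; apply: continuousM; [exact: cf|exact: cg]. Qed.

Lemma derive_continuous f df : (forall x, is_derive x 1 f (df x)) -> continuous f.
Proof.
by move=> dfx x; apply: differentiable_continuous; apply/derivable1_diffP; apply: ex_derive.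
Qed.

Lemma within_continuous (A : set R) f : continuous f -> {within A, continuous f}.
Proof. exact: continuous_subspaceT. Qed.

(** A primitive of f is nondecreasing with equal values at a and b, hence constant, and its
    derivative f vanishes. *)
Lemma Rintegral_eq0_continuous f a b : a < b ->
  {within `[a, b], continuous f} -> {in `]a, b[, forall x, 0 <= f x} ->
  \int[mu]_(x in `]a, b[) f x = 0 -> {in `]a, b[, forall x, f x = 0}.
Proof.
move=> ab cf f0; have [F cF dF] := continuous_primitive ab cf.
rewrite (Rintegral_FTC2 ab cf cF dF) => /eqP; rewrite subr_eq0 => /eqP FbFa.
have Fle : {in `[a, b] &, {homo F : x y / x <= y}}.
  apply: ger0_derive1_le_cc => //.
    by move=> x xab; apply: ex_derive; exact: dF.
  by move=> x xab; rewrite derive1E (@derive_val _ _ _ _ _ _ _ (dF _ xab)) f0.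
have aab : a \in `[a, b] by rewrite bound_itvE ltW.
have bab : b \in `[a, b] by rewrite bound_itvE ltW.
have Fcst x : x \in `]a, b[ -> F x = F a.
  move=> xab; have xab' : x \in `[a, b] by exact: subset_itv_oo_cc.
  move: (xab'); rewrite in_itv /= => /andP[ax xb].
  by apply/eqP; rewrite eq_le -{1}FbFa !Fle.
move=> x xab; have dFx := dF _ xab.
have near_cst : \near x, cst (F a) x = F x.
  by apply: filterS (near_in_itvoo xab) => z zab; rewrite /cst /= Fcst.
have dF0 : is_derive x (1 : R) F 0.
  exact: (@near_eq_is_derive R R^o R^o _ _ _ _ _ near_cst (is_derive_cst _ _ _)).
by rewrite -(@derive_val _ _ _ _ _ _ _ dFx) (@derive_val _ _ _ _ _ _ _ dF0).
Qed.

End IntegralCalculus.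

(** * Weak derivatives of continuous functions *)

Section Derivatives.
Set Implicit Arguments.
Unset Strict Implicit.
Context {R : realType}.
Implicit Types (f g : R -> R) (x a b : R).

Lemma is_derive_add f g x a b : is_derive x 1 f a -> is_derive x 1 g b ->
  is_derive x 1 (fun z => f z + g z) (a + b).
Proof. by move=> df dg; exact: is_deriveD. Qed.

Lemma is_derive_sub f g x a b : is_derive x 1 f a -> is_derive x 1 g b ->
  is_derive x 1 (fun z => f z - g z) (a - b).
Proof. by move=> df dg; exact: is_deriveB. Qed.

Lemma is_derive_mul f g x a b : is_derive x 1 f a -> is_derive x 1 g b ->
  is_derive x 1 (fun z => f z * g z) (a * g x + f x * b).
Proof.
move=> df dg; apply: (is_derive_eq (is_deriveM df dg)).
by rewrite addrC mulrC.
Qed.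

Lemma is_derive_scale f k x a : is_derive x 1 f a ->
  is_derive x 1 (fun z => k * f z) (k * a).
Proof. by move=> df; exact: (is_deriveZ k df). Qed.

Lemma is_derive_affine f (k c x a : R) : is_derive (k * (x + c)) 1 f a ->
  is_derive x 1 (fun z => f (k * (z + c))) (k * a).
Proof.
move=> df; have dk : is_derive x 1 (fun z : R => k * (z + c)) k.
  apply: (is_derive_eq (is_derive_scale k (is_derive_add (is_derive_id x 1) (is_derive_cst c x 1)))).
  by rewrite addr0 mulr1.
by apply: (is_derive_eq (@is_derive1_comp _ f _ x _ _ df dk)); rewrite mulrC.
Qed.

(** A quadratic remainder handles the kink of the truncated square at 0 on the same footing as the
    other points. *)
Lemma is_derive_le_sqr f x a (K : R) :
  (forall h, `|f (x + h) - f x - a * h| <= K * h ^+ 2) -> is_derive x 1 f a.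
Proof.
move=> fK; have K0 : 0 <= K.
  by have := fK 1; rewrite expr1n [K * 1]mulr1; apply: le_trans.
have lim : h^-1 *: (f (h *: 1 + x) - f x) @[h --> 0^'] --> a.
  apply/cvgrPdist_le => e e0; near=> h.
  have h0 : h != 0 by near: h; exact: nbhs_dnbhs_neq.
  have hK : `|h| <= e / (K + 1).
    near: h; apply: dnbhs0_le; rewrite divr_gt0// ltr_wpDl//.
  rewrite /GRing.scale /= mulr1 [h + x]addrC distrC.
  have -> : h^-1 * (f (x + h) - f x) - a = h^-1 * (f (x + h) - f x - a * h).
    by field.
  rewrite normrM normfV.
  apply: (@le_trans _ _ (`|h|^-1 * (K * h ^+ 2))).
    by rewrite ler_wpM2l// invr_ge0.
  rewrite -[h ^+ 2]ger0_norm ?sqr_ge0// normrX expr2 mulrCA mulKf ?normr_eq0//.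
  apply: (@le_trans _ _ ((K + 1) * `|h|)); first by rewrite ler_wpM2r// lerDl.
  by rewrite mulrC -ler_pdivlMr// ltr_wpDl.
apply: DeriveDef; first by apply/cvg_ex; exists a.
exact: (cvg_lim _ lim).
Unshelve. all: by end_near. Qed.

End Derivatives.

(** * Spline test functions and the du Bois-Reymond lemma *)

Section TestFunctions.
Set Implicit Arguments.
Unset Strict Implicit.
Context {R : realType}.
Implicit Types (f g : R -> R) (x a b : R).

(** The truncated power of degree 2: it is C^1, and its second differences are eventually constant
    on both sides. *)
Definition pos_sqr x : R := Num.max x 0 ^+ 2.

Lemma is_derive_pos_sqr x : is_derive x 1 pos_sqr (2 * Num.max x 0).
Proof.
apply: (@is_derive_le_sqr _ pos_sqr _ _ 1) => h; rewrite /pos_sqr mul1r ler_norml.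
by rewrite /Num.max; case: ifP; case: ifP => /=; nra.
Qed.

(* A C^1 step from 0 at a - d to 2 d^2 at a + d, and its derivative, twice a tent
   function centred at a. *)
Definition step a d x : R :=
  pos_sqr (x - a + d) - 2 * pos_sqr (x - a) + pos_sqr (x - a - d).

Definition tent a d x : R :=
  2 * (Num.max (x - a + d) 0 - 2 * Num.max (x - a) 0 + Num.max (x - a - d) 0).

Lemma is_derive_step a d x : is_derive x 1 (step a d) (tent a d x).
Proof.
have dp c : is_derive x 1 (fun z => pos_sqr (z + c)) (2 * Num.max (x + c) 0).
  have := @is_derive_affine _ pos_sqr 1 c x (2 * Num.max (x + c) 0).
  rewrite !mul1r; under eq_fun do rewrite mul1r.
  by apply; exact: is_derive_pos_sqr.
rewrite /step /tent.
have -> : (fun z => pos_sqr (z - a + d) - 2 * pos_sqr (z - a) + pos_sqr (z - a - d)) =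
  (fun z => pos_sqr (z + (- a + d)) - 2 * pos_sqr (z - a) + pos_sqr (z + (- a - d))).
  by apply/funext => z; rewrite !addrA.
apply: (is_derive_eq (is_derive_add
  (is_derive_sub (dp (- a + d)) (is_derive_scale 2 (dp (- a)))) (dp (- a - d)))).
by rewrite !addrA; lra.
Qed.

Lemma tent_ge0 a d x : 0 < d -> 0 <= tent a d x.
Proof. by move=> d0; rewrite /tent /Num.max; do ?case: ifP => /=; lra. Qed.

Lemma tent_eq0 a d x : 0 < d -> d <= `|x - a| -> tent a d x = 0.
Proof.
move=> d0; rewrite /tent; set u := x - a.
rewrite ler_normr => /orP[] ud;
  by rewrite /Num.max; do 3 case: ifP => /=; lra.
Qed.

Lemma tent_center a d : 0 < d -> tent a d a = 2 * d.
Proof. by move=> d0; rewrite /tent subrr /Num.max; do ?case: ifP => /=; lra. Qed.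

Lemma continuous_tent a d : continuous (tent a d).
Proof.
have cmax c c' : continuous (fun x : R => Num.max (x + c + c') 0).
  move=> x; apply: (@continuous_max _ _ (fun z : R => z + c + c') (cst 0)); last exact: cvg_cst.
  by apply: cvgD; [apply: cvgD; [exact: cvg_id|exact: cvg_cst]|exact: cvg_cst].
(* A shift by 0 brings the middle maximum to the two-shift form of [cmax]. *)
move=> x; rewrite /continuous_at /tent -[x - a in X in _ --> X]addr0.
under [X in X @ _]eq_fun do rewrite -[X in 2 * Num.max X _]addr0.
rewrite addr0 -[X in 2 * Num.max X _]addr0.
apply: cvgM; first exact: cvg_cst.
apply: cvgD; last exact: cmax.
apply: cvgB; first exact: cmax.
by apply: cvgM; [exact: cvg_cst|exact: cmax].
Qed.

Lemma step_left a d x : 0 < d -> x <= a - d -> step a d x = 0.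
Proof. by move=> d0 xa; rewrite /step /pos_sqr /Num.max; do ?case: ifP => /=; nra. Qed.

Lemma step_right a d x : 0 < d -> a + d <= x -> step a d x = 2 * d ^+ 2.
Proof. by move=> d0 xa; rewrite /step /pos_sqr /Num.max; do ?case: ifP => /=; nra. Qed.

(** Both steps are 0 far to the left and 2 d^2 far to the right, so they cancel outside a compact
    interval. *)
Lemma test_function_step a b d : 0 < d -> -1 < a - d -> a + d < 1 ->
  -1 < b - d -> b + d < 1 -> test_function (fun x => step a d x - step b d x).
Proof.
move=> d0 ad1 ad2 bd1 bd2.
have dpsi x : is_derive x 1 (fun x => step a d x - step b d x) (tent a d x - tent b d x).
  exact: is_derive_sub (is_derive_step a d x) (is_derive_step b d x).
split.
- by move=> x; exact: ex_derive.
- rewrite (_ : derive1 _ = fun x => tent a d x - tent b d x).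
    by move=> x; apply: continuousB; exact: continuous_tent.
  by apply/funext => x; rewrite derive1E derive_val.
- pose l := Num.min (a - d) (b - d); pose r := Num.max (a + d) (b + d).
  have lr : `[l, r]%classic `<=` (`]-1, 1[%classic : set R).
    move=> x /=; rewrite !in_itv/= => /andP[lx xr]; apply/andP; split.
      by apply: lt_le_trans lx; rewrite lt_min ad1.
    by apply: le_lt_trans xr _; rewrite gt_max ad2.
  apply: subset_trans lr; rewrite (closure_id `[l, r]).1; last exact: itv_closed.
  apply: closure_subset => x /=; rewrite in_itv /=.
  apply: contra_neqT; rewrite negb_and -!ltNge gt_max lt_min => /orP[/andP[xa xb]|/andP[ax bx]].
    by rewrite !step_left ?subrr// ltW.
  by rewrite !step_right ?subrr// ltW.
Qed.

Local Notation mu := (@lebesgue_measure R).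

(** If w b < w a, take m halfway and psi' = tent at a minus tent at b, with w > m on the first tent
    and w < m on the second. As psi' has mean zero, (w - m) psi' has integral 0; it is also
    nonnegative, hence zero, although at a it equals (w a - m) 2 d > 0. *)
Lemma weak_derivative0_cst (w : R -> R) :
  {within `[-1, 1], continuous w} ->
  (forall psi, test_function psi -> \int[mu]_(x in `]-1, 1[) (w x * derive1 psi x) = 0) ->
  {in `]-1, 1[ &, forall a b, w a = w b}.
Proof.
move=> cw w0; have lt11 : -1 < 1 :> R by lra.
suff H : {in `]-1, 1[ &, forall a b, w a <= w b}.
  by move=> a b aI bI; apply/eqP; rewrite eq_le !H.
move=> a b aI bI; rewrite leNgt; apply/negP => wba.
pose m := (w a + w b) / 2.
have [cwI _ _] := (continuous_within_itvP w lt11).1 cw.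
have : \forall x \near a, m < w x /\ x \in `]-1, 1[.
  have /cvgrPdist_lt cwa := cwI _ aI.
  have wam : 0 < w a - m by rewrite /m; lra.
  apply: filterS2 (cwa _ wam) (near_in_itvoo aI) => x wx xI; split => //.
  by have := ler_norm (w a - w x); lra.
move=> /nbhs_ballP[d1 /= d10 near_a].
have : \forall x \near b, w x < m /\ x \in `]-1, 1[.
  have /cvgrPdist_lt cwb := cwI _ bI.
  have wbm : 0 < m - w b by rewrite /m; lra.
  apply: filterS2 (cwb _ wbm) (near_in_itvoo bI) => x wx xI; split => //.
  by have := ler_norm (w x - w b); rewrite distrC; lra.
move=> /nbhs_ballP[d2 /= d20 near_b].
pose d := Num.min d1 d2 / 2.
have d0 : 0 < d by rewrite divr_gt0// lt_min d10.
have dd1 : d < d1.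
  by rewrite /d /Num.min; case: ifPn => [|/negP]; lra.
have dd2 : d < d2.
  by rewrite /d /Num.min; case: ifPn => [|/negP]; lra.
have near_ad x : `|x - a| <= d -> m < w x /\ x \in `]-1, 1[.
  by move=> xa; apply: near_a; rewrite /ball/= distrC; exact: le_lt_trans dd1.
have near_bd x : `|x - b| <= d -> w x < m /\ x \in `]-1, 1[.
  by move=> xb; apply: near_b; rewrite /ball/= distrC; exact: le_lt_trans dd2.
have inI c : (forall x, `|x - c| <= d -> x \in `]-1, 1[) -> -1 < c - d /\ c + d < 1.
  move=> cI; have := cI (c - d); have := cI (c + d).
  rewrite !in_itv/= addrAC subrr add0r addrAC subrr add0r normrN gtr0_norm//.
  by move=> /(_ (lexx _))/andP[_ ->] /(_ (lexx _))/andP[-> _].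
have [ad1 ad2] := inI a (fun x xa => (near_ad x xa).2).
have [bd1 bd2] := inI b (fun x xa => (near_bd x xa).2).
pose psi x := step a d x - step b d x.
pose dpsi x := tent a d x - tent b d x.
have psi_test : test_function psi by exact: test_function_step.
have d_psi x : is_derive x 1 psi (dpsi x).
  exact: is_derive_sub (is_derive_step a d x) (is_derive_step b d x).
have dpsiE : derive1 psi = dpsi.
  by apply/funext => x; rewrite derive1E derive_val.
have cdpsi : {within `[-1, 1], continuous dpsi}.
  by apply: within_continuous => x; apply: continuousB; exact: continuous_tent.
have cpsi : {within `[-1, 1], continuous psi}.
  exact/within_continuous/derive_continuous.
have int_dpsi : \int[mu]_(x in `]-1, 1[) dpsi x = 0.
  rewrite (Rintegral_FTC2 lt11 cdpsi cpsi)//.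
  have step1 c : c + d < 1 -> step c d 1 = 2 * d ^+ 2 by move=> /ltW; exact: step_right.
  have stepN1 c : -1 < c - d -> step c d (-1) = 0 by move=> /ltW; exact: step_left.
  by rewrite /psi !step1// !stepN1// !subrr.
have cm : {within `[-1, 1], continuous (fun _ : R => m)}.
  by apply: within_continuous => x; exact: cvg_cst.
pose h x := (w x - m) * dpsi x.
have ch : {within `[-1, 1], continuous h}.
  exact: within_continuousM (within_continuousB cw cm) cdpsi.
have int_h : \int[mu]_(x in `]-1, 1[) h x = 0.
  rewrite /h; under eq_Rintegral do rewrite mulrBl.
  rewrite RintegralB//; last 2 first.
    exact/integrable_oo_continuous/within_continuousM.
    exact/integrable_oo_continuous/within_continuousM.
  rewrite RintegralZl//; last exact: integrable_oo_continuous.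
  by rewrite int_dpsi mulr0 subr0 -dpsiE w0.
have tb x : w x >= m -> tent b d x = 0.
  move=> wx; apply: tent_eq0 => //; apply/ltW; rewrite ltNge; apply/negP => /near_bd[].
  by rewrite ltNge wx.
have ta x : w x <= m -> tent a d x = 0.
  move=> wx; apply: tent_eq0 => //; apply/ltW; rewrite ltNge; apply/negP => /near_ad[].
  by rewrite ltNge wx.
have h0 : {in `]-1, 1[, forall x, 0 <= h x}.
  move=> x _; rewrite /h /dpsi; have [wx|wx] := lerP (w x) m.
    by rewrite ta// sub0r mulrN -mulNr; apply: mulr_ge0; [lra|exact: tent_ge0].
  by rewrite (tb _ (ltW wx)) subr0; apply: mulr_ge0; [lra|exact: tent_ge0].
have := Rintegral_eq0_continuous lt11 ch h0 int_h aI.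
rewrite /h /dpsi tb; last by rewrite /m; lra.
rewrite tent_center// subr0 => /eqP; rewrite mulf_eq0 => /orP[/eqP|/eqP]; last lra.
by rewrite /m; lra.
Qed.

Lemma test_function_boundary psi : test_function psi -> psi (-1) = 0 :> R /\ psi 1 = 0 :> R.
Proof.
move=> [_ _ supp]; split; apply/eqP; apply/negPn/negP => p0.
  have /supp/= : closure [set x | psi x != 0] (-1) by exact: subset_closure.
  by rewrite in_itv/= ltxx.
have /supp/= : closure [set x | psi x != 0] 1 by exact: subset_closure.
by rewrite in_itv/= ltxx andbF.
Qed.

Lemma Rintegral_test_by_parts f g psi :
  {within `[-1, 1], continuous f} -> {within `[-1, 1], continuous g} ->
  {in `]-1, 1[, forall x, is_derive x 1 f (g x)} -> test_function psi ->
  \int[mu]_(x in `]-1, 1[) (f x * derive1 psi x) =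
  - \int[mu]_(x in `]-1, 1[) (g x * psi x).
Proof.
move=> cf cg df psi_test; have [p0 p1] := test_function_boundary psi_test.
have [dpsi cdpsi _] := psi_test; have lt11 : -1 < 1 :> R by lra.
have d_psi x : is_derive x 1 psi (derive1 psi x).
  by rewrite derive1E; exact/derivableP.
have cpsi : {within `[-1, 1], continuous psi}.
  exact/within_continuous/derive_continuous.
have cdpsi' := @within_continuous _ `[-1, 1]%classic _ cdpsi.
apply/eqP; rewrite -subr_eq0 opprK; apply/eqP; rewrite -RintegralD//; last 2 first.
  exact/integrable_oo_continuous/within_continuousM.
  exact/integrable_oo_continuous/within_continuousM.
rewrite (@Rintegral_FTC2 _ _ (fun x => f x * psi x))//.
- by rewrite p0 p1 !mulr0 subrr.
- by apply: within_continuousD; exact: within_continuousM.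
- exact: within_continuousM.
- move=> x xI; rewrite addrC; exact: is_derive_mul (df _ xI) (d_psi x).
Qed.

(** Subtracting a primitive of g leaves a function with zero weak derivative, that is a constant. *)
Lemma weak_derivative_is_derive f g :
  {within `[-1, 1], continuous f} -> {within `[-1, 1], continuous g} ->
  weak_derivative f g -> {in `]-1, 1[, forall x, is_derive x 1 f (g x)}.
Proof.
move=> cf cg wfg; have lt11 : -1 < 1 :> R by lra.
have [G cG dG] := continuous_primitive lt11 cg.
pose w x := f x - G x.
have cw : {within `[-1, 1], continuous w} by exact: within_continuousB.
have w0 psi : test_function psi -> \int[mu]_(x in `]-1, 1[) (w x * derive1 psi x) = 0.
  move=> psi_test; have [_ cdpsi _] := psi_test.
  have cdpsi' := @within_continuous _ `[-1, 1]%classic _ cdpsi.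
  rewrite /w; under eq_Rintegral do rewrite mulrBl.
  rewrite RintegralB//; last 2 first.
    exact/integrable_oo_continuous/within_continuousM.
    exact/integrable_oo_continuous/within_continuousM.
  by rewrite wfg// (Rintegral_test_by_parts cG cg)// subrr.
have wcst := weak_derivative0_cst cw w0.
move=> x xI; have near_f : \forall z \near x, G z + w x = f z.
  apply: filterS (near_in_itvoo xI) => z zI.
  by rewrite (wcst x z)// /w addrC subrK.
apply: (@near_eq_is_derive R R^o R^o _ _ _ _ _ near_f).
apply: (is_derive_eq (is_derive_add (dG _ xI) (is_derive_cst _ _ _))).
by rewrite addr0.
Qed.

End TestFunctions.

(** * Reduction of the eigenvalue problem to a scalar equation *)

Section FundamentalPair.
Set Implicit Arguments.
Unset Strict Implicit.
Context {R : realType}.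
Local Notation mu := (@lebesgue_measure R).
Implicit Types (S C y dy : R -> R) (m x z sigma : R) (n : int).

(** The Cauchy data at -1 encode the Dirichlet condition there and normalize the slope to 1; all
    three signs of m are covered. *)
Definition fundamental_pair m S C : Prop :=
  [/\ forall x, is_derive x 1 S (C x), forall x, is_derive x 1 C (m * S x),
      S (-1) = 0 & C (-1) = 1].

(** The energy of S'' = m S is a first integral; this unifies the Pythagorean identities for (sin,
    cos) and (sinh, cosh), and prevents S and C from vanishing together. *)
Lemma fundamental_pair_pythagoras m S C : fundamental_pair m S C ->
  forall x, C x ^+ 2 - m * S x ^+ 2 = 1.
Proof.
move=> [dS dC S0 C0] x.
have d0 (t : R) : is_derive t 1 (fun t => C t * C t - m * (S t * S t)) 0.
  apply: (is_derive_eq (is_derive_sub (is_derive_mul (dC t) (dC t))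
    (is_derive_scale m (is_derive_mul (dS t) (dS t))))).
  by ring.
have := is_derive_0_is_cst x (-1) d0.
by rewrite S0 C0 !expr2 => ->; ring.
Qed.

(** The endpoints are included although only continuity holds there: the traces at -1 and 1 have to
    be reached. *)
Lemma is_derive0_within_cst (f : R -> R) (a b : R) :
  {within `[a, b], continuous f} -> {in `]a, b[, forall x, is_derive x 1 f 0} ->
  {in `[a, b], forall x, f x = f a}.
Proof.
move=> cf df x; rewrite in_itv/= => /andP[]; rewrite le_eqVlt => /predU1P[->//|ax xb].
have sub : `[a, x]%classic `<=` `[a, b]%classic.
  by apply: subset_itvl; rewrite bnd_simp.
have dfx t : t \in `]a, x[ -> is_derive t 1 f 0.
  move=> tax; apply: df; move: tax; rewrite !in_itv/= => /andP[->]/= tx.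
  exact: lt_le_trans xb.
have [c _ /eqP] := MVT ax dfx (continuous_subspaceW sub cf).
by rewrite mul0r subr_eq0 => /eqP.
Qed.

(* W1 and W2 below are the Wronskians of (y, dy) with S and with C; they are
   constant, and C^2 - m S^2 = 1 lets one solve for y. *)
Lemma fundamental_pair_solution m S C y dy : fundamental_pair m S C ->
  {within `[-1, 1], continuous y} -> {within `[-1, 1], continuous dy} ->
  {in `]-1, 1[, forall x, is_derive x 1 y (dy x)} ->
  {in `]-1, 1[, forall x, is_derive x 1 dy (m * y x)} ->
  y (-1) = 0 ->
  {in `[-1, 1], forall x, y x = dy (-1) * S x /\ dy x = dy (-1) * C x}.
Proof.
move=> SC cy cdy ddy dddy y0; have [dS dC S0 C0] := SC.
have cS : {within `[-1, 1], continuous S}.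
  exact/within_continuous/derive_continuous.
have cC : {within `[-1, 1], continuous C}.
  exact/within_continuous/derive_continuous.
have cm : {within `[-1, 1], continuous (fun _ : R => m)}.
  by apply: within_continuous => x; exact: cvg_cst.
have W1 : {in `[-1, 1], forall x, y x * C x - dy x * S x = 0}.
  move=> x xI; have -> : 0 = y (-1) * C (-1) - dy (-1) * S (-1).
    by rewrite y0 S0; ring.
  apply: (@is_derive0_within_cst (fun x => y x * C x - dy x * S x) (-1) 1) => //.
    by apply: within_continuousB; exact: within_continuousM.
  move=> t tI; apply: (is_derive_eq (is_derive_sub (is_derive_mul (ddy _ tI) (dC t))
    (is_derive_mul (dddy _ tI) (dS t)))).
  by ring.
have W2 : {in `[-1, 1], forall x, dy x * C x - m * (y x * S x) = dy (-1)}.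
  move=> x xI; have -> : dy (-1) = dy (-1) * C (-1) - m * (y (-1) * S (-1)).
    by rewrite y0 C0; ring.
  apply: (@is_derive0_within_cst (fun x => dy x * C x - m * (y x * S x)) (-1) 1) => //.
    apply: within_continuousB; first exact: within_continuousM.
    by apply: within_continuousM => //; exact: within_continuousM.
  move=> t tI; apply: (is_derive_eq (is_derive_sub (is_derive_mul (dddy _ tI) (dC t))
    (is_derive_scale m (is_derive_mul (ddy _ tI) (dS t))))).
  by ring.
move=> x xI; have P := fundamental_pair_pythagoras SC x.
have w1 := W1 x xI; have w2 := W2 x xI; split.
  rewrite -[LHS]mulr1 -{1}P -w2.
  transitivity (C x * (y x * C x - dy x * S x) + (dy x * C x - m * (y x * S x)) * S x).
    by ring.
  by rewrite w1; ring.
rewrite -[LHS]mulr1 -{1}P -w2.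
transitivity (m * S x * (y x * C x - dy x * S x) + (dy x * C x - m * (y x * S x)) * C x).
  by ring.
by rewrite w1; ring.
Qed.

Lemma L2_continuous y : {within `[-1, 1], continuous y} -> L2 y.
Proof.
move=> cy; have cy2 : {within `[-1, 1], continuous (fun x => y x ^+ 2)}.
  have -> : (fun x => y x ^+ 2) = (fun x => y x * y x) by apply/funext => x; rewrite expr2.
  exact: within_continuousM.
split; last exact: (integrable_oo_continuous cy2).
apply/measurable_EFinP; exact: measurable_int (integrable_oo_continuous cy).
Qed.

(** A change on a null set does not affect a weak derivative, so the continuous function m y may
    replace y'' as weak derivative of y'. Then y is a classical solution, and its amplitude a is
    y'(-1). *)
Lemma A_graph_eigen_solution sigma n z S C (Y : (R -> R) * R) :
  fundamental_pair (z + n%:~R ^+ 2) S C ->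
  A_graph sigma n Y (fun x => z * Y.1 x, z * Y.2) ->
  exists a : R, [/\ {in `[-1, 1], forall x, Y.1 x = a * S x},
    Y.1 1 = - sigma * n%:~R ^+ 2 * Y.2 & z * Y.2 = a * C 1].
Proof.
set m := z + _ => SC [dy [d2y [[[L2y L2dy L2d2y] wy wdy cy cdy] y0 y1 eqae zdy]]].
exists (dy (-1)).
have cm : {within `[-1, 1], continuous (fun _ : R => m)}.
  by apply: within_continuous => x; exact: cvg_cst.
have cmy : {within `[-1, 1], continuous (fun x => m * Y.1 x)}.
  exact: within_continuousM.
have wdy' : weak_derivative dy (fun x => m * Y.1 x).
  move=> psi psi_test; rewrite wdy//; congr (- fine _).
  have [dpsi _ _] := psi_test.
  have cpsi : {within `[-1, 1], continuous psi}.
    apply/within_continuous/derive_continuous => x.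
    by apply: derivableP.
  have [mpsi _] := L2_continuous cpsi.
  apply: ae_eq_integral => //.
  - by apply/measurable_EFinP/measurable_funM => //; case: L2d2y.
  - by apply/measurable_EFinP/measurable_funM => //; case: (L2_continuous cmy).
  - case: eqae => N [mN N0 subN]; exists N; split => //.
    apply: subset_trans subN => x /= /not_implyP[xI neq]; apply/not_implyP; split => //.
    apply: contra_not neq => zE.
    by congr (_ * _)%:E; rewrite /m mulrDl zE subrK.
have ddy := weak_derivative_is_derive cy cdy wy.
have dddy := weak_derivative_is_derive cdy cmy wdy'.
have sol := fundamental_pair_solution SC cy cdy ddy dddy y0.
split => //; first by move=> x /sol[].
have oneI : (1 : R) \in `[-1, 1] by rewrite in_itv/=; lra.
by move: zdy => /= ->; have [] := sol _ oneI.
Qed.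

Lemma weak_derivative_continuous y dy : (forall x, is_derive x 1 y (dy x)) ->
  continuous dy -> weak_derivative y dy.
Proof.
move=> ddy cdy psi psi_test; apply: Rintegral_test_by_parts => //.
- exact/within_continuous/derive_continuous.
- exact: within_continuous.
Qed.

Lemma Hdot_eq0 sigma n y : {in `[-1, 1], forall x, y x = 0} ->
  Hdot sigma n (y, 0) (y, 0) = 0.
Proof.
move=> y0; rewrite /Hdot/= mulr0 addr0 /L2dot.
rewrite (@eq_Rintegral _ _ _ _ _ (cst 0)); first by rewrite Rintegral_cst// mul0r.
move=> x; rewrite inE/= => xI.
by rewrite y0 ?mul0r//; exact: subset_itv_oo_cc.
Qed.

(** The conditions at 1 are two linear equations in (a, h); eliminating h and cancelling a gives the
    scalar equation. *)
Lemma eigenvaluesP sigma n z S C : 0 < sigma -> n != 0 ->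
  fundamental_pair (z + n%:~R ^+ 2) S C ->
  eigenvalues sigma n z <-> sigma * n%:~R ^+ 2 * C 1 + z * S 1 = 0.
Proof.
move=> s0 n0 SC; have [dS dC S0 C0] := SC.
have sn0 : 0 < sigma * n%:~R ^+ 2.
  by rewrite mulr_gt0// exprn_even_gt0// intr_eq0.
have cS : continuous S := derive_continuous dS.
have cC : continuous C := derive_continuous dC.
have oneI : (1 : R) \in `[-1, 1] by rewrite in_itv/=; lra.
split.
  move=> [[y h] [/= Yn0 /(A_graph_eigen_solution SC)[a [/= yS y1 zh]]]].
  (* A zero amplitude would also force h = 0 through the boundary condition, against the nonzero
     norm. *)
  have a0 : a != 0.
    apply: contra_neq Yn0 => a0; rewrite /Hnorm.
    have -> : h = 0.
      have := y1; rewrite (yS _ oneI) a0 mul0r !mulNr => /esym/eqP.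
      by rewrite oppr_eq0 mulf_eq0 (gt_eqF sn0) => /eqP.
    by rewrite Hdot_eq0 ?sqrtr0// => x xI; rewrite yS// a0 mul0r.
  apply: (mulfI a0); rewrite mulr0; move: y1; rewrite (yS _ oneI) => aS1.
  transitivity (sigma * n%:~R ^+ 2 * (a * C 1) + z * (a * S 1)); first by ring.
  by rewrite -zh aS1; ring.
move=> char; pose h := - S 1 / (sigma * n%:~R ^+ 2).
(* If S(1) = 0, the equation gives C(1) = 0, against the first integral. Thus h is nonzero, and the
   second component alone makes the norm positive. *)
have S1 : S 1 != 0.
  apply/eqP => S10; move: char; rewrite S10 mulr0 addr0 => /eqP.
  rewrite mulf_eq0 (gt_eqF sn0) /= => /eqP C10.
  by have := fundamental_pair_pythagoras SC 1; rewrite S10 C10; lra.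
exists (S, h); split.
  rewrite /Hnorm gt_eqF// sqrtr_gt0 /Hdot/= ltr_wpDl//.
    by apply: Rintegral_ge0 => x _; rewrite -expr2 sqr_ge0.
  rewrite -mulrA -expr2 mulr_gt0// exprn_even_gt0//=.
  by rewrite /h mulf_neq0 ?oppr_eq0// invr_eq0 gt_eqF.
have cmS : continuous (fun x => (z + n%:~R ^+ 2) * S x).
  by move=> x; apply: cvgM; [exact: cvg_cst|exact: cS].
exists C, (fun x => (z + n%:~R ^+ 2) * S x); split => //=.
- split.
  + by split; apply/L2_continuous/within_continuous.
  + exact: weak_derivative_continuous.
  + exact: weak_derivative_continuous.
  + exact: within_continuous.
  + exact: within_continuous.
- by rewrite /h !mulNr mulrN opprK mulrCA divff ?mulr1// gt_eqF.
- by apply: aeW => x _; ring.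
- have sh : sigma * n%:~R ^+ 2 * h = - S 1 by rewrite /h mulrC divfK ?gt_eqF.
  apply: (mulfI (lt0r_neq0 sn0)); rewrite mulrCA sh mulrN.
  by apply/eqP; rewrite eq_sym -addr_eq0 char.
Qed.

End FundamentalPair.

(** * Elementary functions *)

Section ElementaryFunctions.
Set Implicit Arguments.
Unset Strict Implicit.
Context {R : realType}.
Implicit Types (f df : R -> R) (x y t : R).

Lemma mean_value f df x y : x < y ->
  (forall t, x <= t <= y -> is_derive t 1 f (df t)) ->
  exists2 c, x < c < y & f y - f x = df c * (y - x).
Proof.
move=> xy dfx; have [] := @MVT R f df x y xy.
- move=> t; rewrite in_itv/= => /andP[xt ty]; apply: dfx.
  by rewrite !ltW.
- apply: derivable_within_continuous => t; rewrite in_itv/= => xty.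
  by have := dfx _ xty => dft; exact: ex_derive.
- by move=> c; rewrite in_itv/= => cI e; exists c.
Qed.

(** Mean values of f' on (0, x) and (x, y) compare adjacent chords. This is the increase of f(t) / t
    without division, for use with tan and - tanh. *)
Lemma secant_slope_lt f df (b : R) : f 0 = 0 ->
  (forall t, 0 <= t < b -> is_derive t 1 f (df t)) ->
  (forall s t, 0 < s -> s < t -> t < b -> df s < df t) ->
  forall x y, 0 < x -> x < y -> y < b -> y * f x < x * f y.
Proof.
move=> f0 dfx incr x y x0 xy yb.
have [c1 /andP[c10 c1x]] : exists2 c, 0 < c < x & f x - f 0 = df c * (x - 0).
  by apply: mean_value => // t /andP[t0 tx]; apply: dfx; rewrite t0; lra.
have [c2 /andP[xc2 c2y] e2] : exists2 c, x < c < y & f y - f x = df c * (y - x).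
  by apply: mean_value => // t /andP[t0 tx]; apply: dfx; apply/andP; split; lra.
rewrite f0 !subr0 => e1.
have dc : df c1 < df c2 by apply: incr; lra.
have -> : f y = f x + df c2 * (y - x) by rewrite -e2; ring.
rewrite e1 -subr_gt0.
have -> : x * (df c1 * x + df c2 * (y - x)) - y * (df c1 * x) =
  x * (y - x) * (df c2 - df c1) by ring.
by rewrite !mulr_gt0// subr_gt0.
Qed.

Lemma sin_lt x : 0 < x -> sin x < x.
Proof.
move=> x0; have [x1|x1] := ltrP 1 x; first exact: le_lt_trans (sin_le1 _) x1.
have [c /andP[c0 cx]] := mean_value x0 (fun t _ => is_derive_sin t).
rewrite sin0 !subr0 => ->; rewrite -[ltRHS]mul1r ltr_pM2r// -[ltRHS]cos0.
have pi2 := @pi_ge2 R.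
by rewrite ltr_cos// in_itv/=; apply/andP; split; lra.
Qed.

Lemma norm_sin_lt x : 0 < x -> `|sin x| < x.
Proof.
move=> x0; rewrite ltr_norml sin_lt// andbT.
have [x1|x1] := ltrP 1 x; first by have := sin_geN1 x; lra.
have : 0 < sin x by apply: sin_gt0_pi; have := @pi_ge2 R; lra.
lra.
Qed.

Lemma sin_lipschitz x y : x <= y -> `|sin y - sin x| <= y - x.
Proof.
rewrite le_eqVlt => /predU1P[->|xy]; first by rewrite !subrr normr0.
have [c _ ->] := mean_value xy (fun t _ => is_derive_sin t).
have yx : 0 < y - x by rewrite subr_gt0.
by rewrite normrM (gtr0_norm yx) ler_piMl ?cos_max// ltW.
Qed.

(** The function |sin| is 1-Lipschitz, since sin is. *)
Lemma sub_norm_sin_homo x y : x <= y -> x - `|sin x| <= y - `|sin y|.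
Proof.
move=> /sin_lipschitz; have := lerB_dist (sin y) (sin x); lra.
Qed.

(** The derivative of sin t - t cos t is t sin t. Being free of tan, the inequality includes x = pi
    / 2. *)
Lemma mul_cos_lt_sin x : 0 < x -> x <= pi / 2 -> x * cos x < sin x.
Proof.
move=> x0 xpi; have dg t : is_derive t 1 (fun t : R => sin t - t * cos t) (t * sin t).
  apply: (is_derive_eq (is_derive_sub (is_derive_sin t)
    (is_derive_mul (is_derive_id t 1) (is_derive_cos t)))).
  by ring.
have [c /andP[c0 cx]] := mean_value x0 (fun t _ => dg t).
rewrite sin0 mul0r !subr0 => e; rewrite -subr_gt0 e !mulr_gt0// sin_gt0_pi//.
by rewrite c0 /=; have := @pi_gt0 R; lra.
Qed.

Lemma tan_secant_lt x y : 0 < x -> x < y -> y < pi / 2 -> y * tan x < x * tan y.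
Proof.
apply: (@secant_slope_lt tan (fun t => (cos t) ^- 2)) => [|t tI|s t s0 st tb].
- exact: tan0.
- apply: is_derive_tan; rewrite gt_eqF// cos_gt0_pihalf//.
  by have := @pi_gt0 R; lra.
- have pi0 := @pi_gt0 R.
  have ct : 0 < cos t by apply: cos_gt0_pihalf; lra.
  have cs : cos t < cos s.
    by rewrite ltr_cos// in_itv/=; apply/andP; split; lra.
  by rewrite ltf_pV2 ?posrE ?exprn_gt0//; [rewrite ltr_pXn2r// nnegrE ltW//; exact: lt_trans cs|exact: lt_trans cs].
Qed.

Definition sinh x : R := (expR x - expR (- x)) / 2.
Definition cosh x : R := (expR x + expR (- x)) / 2.

Lemma is_derive_expRN x : is_derive x 1 (fun t : R => expR (- t)) (- expR (- x)).
Proof.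
apply: (is_derive_eq (@is_derive1_comp _ expR -%R x _ _ (is_derive_expR _) (is_deriveNid _ _))).
by rewrite mulrN1.
Qed.

Lemma is_derive_sinh x : is_derive x 1 sinh (cosh x).
Proof.
have := is_derive_scale (2^-1) (is_derive_sub (is_derive_expR x) (is_derive_expRN x)).
rewrite opprK /cosh mulrC; congr is_derive; apply/funext => t.
by rewrite /sinh mulrC.
Qed.

Lemma is_derive_cosh x : is_derive x 1 cosh (sinh x).
Proof.
have := is_derive_scale (2^-1) (is_derive_add (is_derive_expR x) (is_derive_expRN x)).
rewrite /sinh mulrC; congr is_derive; apply/funext => t.
by rewrite /cosh mulrC.
Qed.

Lemma sinh0 : sinh 0 = 0.
Proof. by rewrite /sinh oppr0 subrr mul0r. Qed.

Lemma cosh0 : cosh 0 = 1.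
Proof. by rewrite /cosh oppr0 expR0; lra. Qed.

Lemma cosh2_sinh2 x : cosh x ^+ 2 - sinh x ^+ 2 = 1.
Proof.
have e : expR x * expR (- x) = 1 by rewrite expRN divff// gt_eqF// expR_gt0.
by rewrite /cosh /sinh -[RHS]e; field.
Qed.

Lemma sinh_gt0 x : 0 < x -> 0 < sinh x.
Proof. by move=> x0; rewrite divr_gt0// subr_gt0 ltr_expR; lra. Qed.

Lemma sinh_lt_cosh x : sinh x < cosh x.
Proof.
by rewrite ltr_pM2r// ltrD2l (lt_trans _ (expR_gt0 _))// oppr_lt0 expR_gt0.
Qed.

Lemma cosh_lt x y : 0 <= x -> x < y -> cosh x < cosh y.
Proof.
move=> x0 xy; have [c /andP[xc _] e] := mean_value xy (fun t _ => is_derive_cosh t).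
by rewrite -subr_gt0 e mulr_gt0 ?subr_gt0// sinh_gt0//; exact: le_lt_trans xc.
Qed.

Lemma cosh_ge1 x : 0 <= x -> 1 <= cosh x.
Proof.
rewrite le_eqVlt => /predU1P[<-|x0]; first by rewrite cosh0.
by rewrite -cosh0 ltW// cosh_lt.
Qed.

Lemma lt_sinh x : 0 < x -> x < sinh x.
Proof.
move=> x0; have [c /andP[c0 _]] := mean_value x0 (fun t _ => is_derive_sinh t).
rewrite sinh0 !subr0 => ->; rewrite -[ltLHS]mul1r ltr_pM2r//.
by rewrite -cosh0 cosh_lt.
Qed.

Lemma sinh_lt_mul_cosh x : 0 < x -> sinh x < x * cosh x.
Proof.
move=> x0; have [c /andP[c0 cx]] := mean_value x0 (fun t _ => is_derive_sinh t).
by rewrite sinh0 !subr0 => ->; rewrite mulrC ltr_pM2l// cosh_lt// ltW.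
Qed.

Lemma sinh_lt x y : x < y -> sinh x < sinh y.
Proof. by move=> xy; rewrite ltr_pM2r// ltrB// ltr_expR// ltrN2. Qed.

(** The negative of tanh has the increasing derivative - 1 / cosh^2 on the positive axis; y + 1 is
    an arbitrary right end beyond y. *)
Lemma tanh_secant_lt x y : 0 < x -> x < y ->
  x * (sinh y / cosh y) < y * (sinh x / cosh x).
Proof.
move=> x0 xy; pose f t := - (sinh t / cosh t).
have ch t : 0 <= t -> 0 < cosh t by move=> /cosh_ge1; exact: lt_le_trans.
have df t : 0 <= t < y + 1 -> is_derive t 1 f (- (cosh t ^- 2)).
  move=> /andP[t0 _]; have c0 := ch _ t0.
  have cn0 : cosh t != 0 by rewrite gt_eqF.
  have dV := is_deriveV cn0 (is_derive_cosh t).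
  apply: (is_derive_eq (is_deriveN (is_derive_mul (is_derive_sinh t) dV))).
  congr (- _); rewrite -[in RHS](mul1r (_ ^- 2)) -(cosh2_sinh2 t) /GRing.scale /=.
  by field.
have f0 : f 0 = 0 by rewrite /f sinh0 mul0r oppr0.
have incr s t : 0 < s -> s < t -> t < y + 1 -> - (cosh s ^- 2) < - (cosh t ^- 2).
  move=> s0 st _; have cs := ch _ (ltW s0); have ct := ch _ (ltW (lt_trans s0 st)).
  rewrite ltrN2 ltf_pV2 ?posrE ?exprn_gt0// ltr_pXn2r ?nnegrE ?(ltW cs) ?(ltW ct)//.
  exact: cosh_lt (ltW s0) st.
have yb : y < y + 1 by lra.
by have := secant_slope_lt f0 df incr x0 xy yb; rewrite /f !mulrN ltrN2.
Qed.

End ElementaryFunctions.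

(** * Roots of the characteristic equations *)

Section CharacteristicEquations.
Set Implicit Arguments.
Unset Strict Implicit.
Context {R : realType}.
Implicit Types (sigma N w v t : R) (k : nat).

(* In the next two definitions N stands for n^2, and the eigenvalue is
   - w^2 - N, respectively v^2 - N. *)
Definition osc_root sigma N w : Prop :=
  sigma * N * w * cos (2 * w) = (N + w ^+ 2) * sin (2 * w).

Definition hyp_root sigma N v : Prop :=
  sigma * N * v * cosh (2 * v) = (N - v ^+ 2) * sinh (2 * v).

Lemma sin_shift k t : sin (2 * (k%:R * pi / 2 + t)) = (-1) ^+ k * sin (2 * t) :> R.
Proof.
have -> : 2 * (k%:R * pi / 2 + t) = 2 * t + pi *+ k :> R.
  by rewrite -[pi *+ k]mulr_natl; field.
exact: (alternatingn (@sinDpi R)).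
Qed.

Lemma cos_shift k t : cos (2 * (k%:R * pi / 2 + t)) = (-1) ^+ k * cos (2 * t) :> R.
Proof.
have -> : 2 * (k%:R * pi / 2 + t) = 2 * t + pi *+ k :> R.
  by rewrite -[pi *+ k]mulr_natl; field.
exact: (alternatingn (@cosDpi R)).
Qed.

(** Doubling turns the offset k pi / 2 into k pi, which multiplies sine and cosine by the same sign;
    k survives only in the polynomial factors. *)
Lemma osc_root_shift sigma N k t (w := k%:R * pi / 2 + t) :
  osc_root sigma N w <-> sigma * N * w * cos (2 * t) = (N + w ^+ 2) * sin (2 * t).
Proof.
rewrite /osc_root {2}/w cos_shift {3}/w sin_shift -/w.
have sgn : (-1) ^+ k != 0 :> R by rewrite signr_eq0.
rewrite mulrCA [X in _ = X]mulrCA; split => [|->//].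
exact: mulfI.
Qed.

Lemma pos_near0 (f : R -> R) (b : R) : continuous f -> 0 < f 0 -> 0 < b ->
  exists2 t, 0 < t < b & 0 < f t.
Proof.
move=> cf f0 b0; have : \forall t \near 0, 0 < f t.
  have /cvgrPdist_lt/(_ _ f0) := cf 0.
  by apply: filterS => t ft; have := ler_norm (f 0 - f t); lra.
move=> /nbhs_ballP[d /= d0 near0].
have m0 : 0 < Num.min d b by rewrite lt_min d0.
have md : Num.min d b <= d by rewrite ge_min lexx.
have mb : Num.min d b <= b by rewrite ge_min lexx orbT.
exists (Num.min d b / 2); first by apply/andP; split; lra.
by apply: near0; rewrite /ball/= sub0r normrN gtr0_norm; lra.
Qed.

Lemma continuous_root (f : R -> R) a b : continuous f -> a <= b ->
  f b <= 0 <= f a \/ f a <= 0 <= f b -> exists2 c, a <= c <= b & f c = 0.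
Proof.
move=> cf ab fab; have := @IVT R f a b 0 ab (@within_continuous _ `[a, b]%classic f cf).
case=> [|c]; last by rewrite in_itv/= => cI e; exists c.
by rewrite ge_min le_max; case: fab => /andP[-> ->]; rewrite ?orbT.
Qed.

Lemma continuous_osc sigma N (c : R) :
  continuous (fun t => sigma * N * (c + t) * cos (2 * t) - (N + (c + t) ^+ 2) * sin (2 * t)).
Proof.
have c2 : continuous (fun t : R => 2 * t).
  by move=> t; apply: cvgM; [exact: cvg_cst|exact: cvg_id].
have cc : continuous (fun t : R => c + t).
  by move=> t; apply: cvgD; [exact: cvg_cst|exact: cvg_id].
move=> t; apply: cvgB; apply: cvgM.
- by apply: cvgM; [exact: cvg_cst|exact: cc].
- by apply: (@continuous_comp _ _ _ (fun t : R => 2 * t) cos); [exact: c2|exact: continuous_cos].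
- by apply: cvgD; [exact: cvg_cst|apply: cvgM; exact: cc].
- by apply: (@continuous_comp _ _ _ (fun t : R => 2 * t) sin); [exact: c2|exact: continuous_sin].
Qed.

(** E is the difference of the two sides. It is negative at pi / 4, where the cosine vanishes, and
    positive at 0 when k > 0. For k = 0 it vanishes at 0, and positivity just after 0 comes from
    sigma > 2. *)
Lemma osc_root_exists sigma N k : 0 < sigma -> 0 < N -> (0 < k)%N \/ 2 < sigma ->
  exists2 t, 0 < t < pi / 4 & osc_root sigma N (k%:R * pi / 2 + t).
Proof.
move=> s0 N0 hk; have pi0 := @pi_gt0 R.
pose c : R := k%:R * pi / 2.
have c0 : 0 <= c by rewrite !mulr_ge0 ?invr_ge0// ltW.
pose E t := sigma * N * (c + t) * cos (2 * t) - (N + (c + t) ^+ 2) * sin (2 * t).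
have cE : continuous E by exact: continuous_osc.
have [t0 /andP[t00 t0pi] Et0] : exists2 t, 0 < t < pi / 4 & 0 < E t.
  have [k0|k0] := posnP k; last first.
    apply: pos_near0 => //; last by lra.
    rewrite /E mulr0 sin0 cos0 addr0 mulr1 mulr0 subr0 !mulr_gt0//.
    by rewrite ltr0n.
  have s2 : 2 < sigma by case: hk; rewrite ?k0.
  (* By sin(2t) < 2t one has E(t) >= t P(t), and P(0) = (sigma - 2) N > 0. *)
  pose P t := sigma * N * cos (2 * t) - 2 * (N + t ^+ 2).
  have cP : continuous P.
    move=> t; apply: cvgB; apply: cvgM; first exact: cvg_cst.
    - apply: (@continuous_comp _ _ _ (fun t : R => 2 * t) cos); last exact: continuous_cos.
      by apply: cvgM; [exact: cvg_cst|exact: cvg_id].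
    - exact: cvg_cst.
    - by apply: cvgD; [exact: cvg_cst|apply: cvgM; exact: cvg_id].
  have P0 : 0 < P 0 by rewrite /P mulr0 cos0 expr0n/= addr0 mulr1 -mulrBl mulr_gt0//; lra.
  have pi4 : 0 < pi / 4 :> R by lra.
  have [t /andP[t0 tpi] Pt] := pos_near0 cP P0 pi4.
  exists t; first by rewrite t0.
  have t20 : 0 < 2 * t by lra.
  have sin2t := sin_lt t20.
  rewrite /E /c k0 !mul0r add0r.
  have h : (N + t ^+ 2) * sin (2 * t) <= (N + t ^+ 2) * (2 * t).
    by rewrite ler_wpM2l ?(ltW sin2t)// ltW// ltr_wpDr ?sqr_ge0.
  have : 0 < t * P t by rewrite mulr_gt0.
  by rewrite /P; lra.
have E1 : E (pi / 4) <= 0.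
  rewrite /E (_ : 2 * (pi / 4) = pi / 2); last by field.
  rewrite cos_pihalf sin_pihalf mulr0 mulr1 sub0r oppr_le0.
  by rewrite addr_ge0 ?sqr_ge0// ltW.
have [t /andP[tt0 tpi] Et] : exists2 t, t0 <= t <= pi / 4 & E t = 0.
  by apply: continuous_root => //; [exact: ltW|left; rewrite E1 ltW].
exists t; last first.
  by apply/osc_root_shift; apply/eqP; rewrite -subr_eq0; apply/eqP.
rewrite (lt_le_trans t00 tt0)/= lt_neqAle tpi andbT; apply/eqP => tE.
move: Et; rewrite tE /E (_ : 2 * (pi / 4) = pi / 2); last by field.
rewrite cos_pihalf sin_pihalf mulr0 mulr1 sub0r => /eqP.
by rewrite oppr_eq0 gt_eqF// ltr_pwDl ?sqr_ge0.
Qed.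

(** At a root, (N + w^2) tan(2t) / w equals sigma N. Both N + w^2 and tan(2t) / w increase with t,
    so this value is taken at most once; the symmetric use of the lemma gives uniqueness. *)
Lemma osc_root_le sigma N k t t' : 0 < sigma -> 0 < N ->
  0 < t < pi / 4 -> 0 < t' < pi / 4 ->
  osc_root sigma N (k%:R * pi / 2 + t) -> osc_root sigma N (k%:R * pi / 2 + t') ->
  t' <= t.
Proof.
move=> s0 N0 /andP[t0 tpi] /andP[t'0 t'pi] /osc_root_shift + /osc_root_shift.
rewrite leNgt => e e'; apply/negP => tt'.
have pi0 := @pi_gt0 R.
move: e e'; set w := _ + t; set w' := _ + t' => e e'.
have c0 : 0 <= k%:R * pi / 2 :> R by rewrite !mulr_ge0 ?invr_ge0// ltW.
have w0 : 0 < w by rewrite /w; lra.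
have ww' : w < w' by rewrite /w /w'; lra.
have ct : 0 < cos (2 * t) by apply: cos_gt0_pihalf; lra.
have ct' : 0 < cos (2 * t') by apply: cos_gt0_pihalf; lra.
have eT : sigma * N * w = (N + w ^+ 2) * tan (2 * t).
  by apply: (mulIf (lt0r_neq0 ct)); rewrite e /tan -mulrA divfK// gt_eqF.
have eT' : sigma * N * w' = (N + w' ^+ 2) * tan (2 * t').
  by apply: (mulIf (lt0r_neq0 ct')); rewrite e' /tan -mulrA divfK// gt_eqF.
have st : 0 < sin (2 * t) by apply: sin_gt0_pihalf; lra.
have T0 : 0 < tan (2 * t) by rewrite divr_gt0.
have sec : 2 * t' * tan (2 * t) < 2 * t * tan (2 * t').
  by apply: tan_secant_lt; lra.
move: eT eT' T0 sec; move: (tan (2 * t)) (tan (2 * t')) => T T' eT eT' T0 sec.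
have tT : t * T < t' * T by rewrite ltr_pM2r.
have TT' : T < T' by rewrite -(ltr_pM2l t0); lra.
(* The offset k pi / 2 is nonnegative and T < T', so the secant inequality passes from t to w. *)
have wT : w' * T < w * T'.
  have : k%:R * pi / 2 * T <= k%:R * pi / 2 * T' by rewrite ler_wpM2l// ltW.
  by rewrite /w /w'; lra.
have : w' * T * (N + w ^+ 2) < w * T' * (N + w' ^+ 2).
  apply: ltr_pM => //.
  - by rewrite mulr_ge0 ?ltW// (lt_trans w0).
  - by rewrite addr_ge0 ?sqr_ge0// ltW.
  - by rewrite ltrD2l ltr_pXn2r// nnegrE ltW// (lt_trans w0).
have -> : w' * T * (N + w ^+ 2) = w' * (sigma * N * w) by rewrite eT; ring.
have -> : w * T' * (N + w' ^+ 2) = w * (sigma * N * w') by rewrite eT'; ring.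
by rewrite (_ : w' * _ = w * (sigma * N * w')) ?ltxx//; ring.
Qed.

(** With k the integer part of 2w / pi, t lies in [0, pi / 2). The equation excludes t = 0 and gives
    cos(2t) the sign of sin(2t), whence t < pi / 4. For k = 0 and sigma <= 2 it contradicts u cos u
    < sin u at u = 2t. *)
Lemma osc_root_location sigma N w : 0 < sigma -> 0 < N -> 0 < w -> osc_root sigma N w ->
  exists k, exists2 t, 0 < t < pi / 4 &
    [/\ w = k%:R * pi / 2 + t & (0 < k)%N \/ 2 < sigma].
Proof.
move=> s0 N0 w0 hw; have pi0 := @pi_gt0 R.
have /truncn_itv/andP[k1 k2] : 0 <= 2 * w / pi by rewrite divr_ge0 ?ltW//; lra.
set k := Num.truncn _ in k1 k2; exists k.
pose t := w - k%:R * pi / 2.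
have wE : w = k%:R * pi / 2 + t by rewrite /t; ring.
have t0 : 0 <= t by move: k1; rewrite ler_pdivlMr// /t; lra.
have tpi : t < pi / 2.
  by move: k2; rewrite ltr_pdivrMr// -[k.+1%:R]natr1 /t; lra.
move: hw; rewrite wE => /osc_root_shift; rewrite -wE => e.
have sw : 0 < sigma * N * w by rewrite !mulr_gt0.
have Nw : 0 < N + w ^+ 2 by rewrite ltr_pwDl ?sqr_ge0.
have {}t0 : 0 < t.
  rewrite lt_neqAle t0 andbT; apply/eqP => te.
  move: e; rewrite -te mulr0 cos0 sin0 mulr1 mulr0 => /eqP.
  by rewrite gt_eqF.
have st : 0 < sin (2 * t) by apply: sin_gt0_pi; lra.
have ct : 0 < cos (2 * t).
  by rewrite -(pmulr_rgt0 _ sw) e mulr_gt0.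
have {}tpi : t < pi / 4.
  rewrite ltNge; apply/negP => tpi4; move: ct; rewrite ltNge => /negP; apply.
  rewrite (_ : 2 * t = (2 * t - pi / 2) + pi / 2); last by ring.
  by rewrite cosDpihalf oppr_le0 sin_ge0_pi//; apply/andP; split; lra.
exists t; first by rewrite t0.
split => //; have [k0|k0] := posnP k; [right|by left].
rewrite ltNge; apply/negP => s2.
have wt : w = t by rewrite wE k0; ring.
have h1 : 2 * t * cos (2 * t) < sin (2 * t) by apply: mul_cos_lt_sin; lra.
have h2 : sigma * (N * w * cos (2 * t)) <= 2 * (N * w * cos (2 * t)).
  by rewrite ler_wpM2r// !mulr_ge0// ltW.
have h3 : N * (2 * t * cos (2 * t)) < N * sin (2 * t) by rewrite ltr_pM2l.
have h4 : 0 <= w ^+ 2 * sin (2 * t) by rewrite mulr_ge0 ?sqr_ge0// ltW.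
by move: e; rewrite -!wt in h1 h2 h3 h4 *; lra.
Qed.

(** The bounds follow from sinh u < u cosh u, sinh < cosh and the positivity of both sides, in this
    order. The second is free of N, hence uniform in n; the third makes the eigenvalue negative. *)
Lemma hyp_root_bounds sigma N v : 0 < sigma -> 0 < N -> 0 < v -> hyp_root sigma N v ->
  [/\ sigma < 2, v < 1 / sigma & v ^+ 2 < N].
Proof.
rewrite /hyp_root => s0 N0 v0 e; have v20 : 0 < 2 * v by lra.
have S0 := sinh_gt0 v20.
have Ch : 0 < cosh (2 * v) by apply: lt_le_trans (cosh_ge1 (ltW v20)).
have Nv : 0 < N - v ^+ 2.
  by rewrite -(pmulr_lgt0 _ S0) -e mulr_gt0// !mulr_gt0.
have SC : sinh (2 * v) < cosh (2 * v).
  exact: sinh_lt_cosh.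
split; last by lra.
- rewrite ltNge; apply/negP => s2.
  have h1 := sinh_lt_mul_cosh v20.
  have h2 : 2 * (N * v * cosh (2 * v)) <= sigma * (N * v * cosh (2 * v)).
    by rewrite ler_wpM2r// !mulr_ge0// ltW.
  have h3 : N * sinh (2 * v) < N * (2 * v * cosh (2 * v)) by rewrite ltr_pM2l.
  have h4 : 0 <= v ^+ 2 * sinh (2 * v) by rewrite mulr_ge0 ?sqr_ge0// ltW.
  by lra.
- rewrite ltr_pdivlMr// -(ltr_pM2l N0) -(ltr_pM2r S0).
  have h1 : sigma * N * v * sinh (2 * v) < sigma * N * v * cosh (2 * v).
    by rewrite ltr_pM2l ?mulr_gt0.
  have h4 : 0 <= v ^+ 2 * sinh (2 * v) by rewrite mulr_ge0 ?sqr_ge0// ltW.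
  by lra.
Qed.

Lemma hyp_root_exists sigma N : 0 < sigma -> sigma < 2 -> 0 < N ->
  exists2 v, 0 < v & hyp_root sigma N v.
Proof.
move=> s0 s2 N0.
pose E v := sigma * N * v * cosh (2 * v) - (N - v ^+ 2) * sinh (2 * v).
have c2 : continuous (fun t : R => 2 * t).
  by move=> t; apply: cvgM; [exact: cvg_cst|exact: cvg_id].
have cch : continuous (fun t : R => cosh (2 * t)).
  by move=> t; apply: (@continuous_comp _ _ _ (fun t : R => 2 * t) cosh);
    [exact: c2|exact: (derive_continuous is_derive_cosh)].
have csh : continuous (fun t : R => sinh (2 * t)).
  by move=> t; apply: (@continuous_comp _ _ _ (fun t : R => 2 * t) sinh);
    [exact: c2|exact: (derive_continuous is_derive_sinh)].
have cE : continuous E.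
  move=> t; apply: cvgB; apply: cvgM.
  - by apply: cvgM; [exact: cvg_cst|exact: cvg_id].
  - exact: cch.
  - by apply: cvgB; [exact: cvg_cst|apply: cvgM; exact: cvg_id].
  - exact: csh.
(* By sinh(2t) > 2t one has E(t) <= - t P(t) for 0 < t < sqrt N, with P(0) = (2 - sigma) N > 0. At
   sqrt N the sinh term disappears and E is nonnegative. *)
pose P t := 2 * (N - t ^+ 2) - sigma * N * cosh (2 * t).
have cP : continuous P.
  move=> t; apply: cvgB; apply: cvgM; try exact: cvg_cst.
  - by apply: cvgB; [exact: cvg_cst|apply: cvgM; exact: cvg_id].
  - exact: cch.
have P0 : 0 < P 0.
  by rewrite /P mulr0 cosh0 expr0n/= subr0 mulr1 -mulrBl mulr_gt0//; lra.
have rN0 : 0 < Num.sqrt N by rewrite sqrtr_gt0.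
have [t /andP[t0 tN] Pt] := pos_near0 cP P0 rN0.
have t20 : 0 < 2 * t by lra.
have Nt : 0 < N - t ^+ 2.
  by rewrite subr_gt0 -[ltRHS](sqr_sqrtr (ltW N0)) ltr_pXn2r// nnegrE ltW.
have Et : E t <= 0.
  have h : (N - t ^+ 2) * (2 * t) <= (N - t ^+ 2) * sinh (2 * t).
    by rewrite ler_pM2l// ltW// lt_sinh.
  have : 0 < t * P t by rewrite mulr_gt0.
  by rewrite /P /E; lra.
have EN : 0 <= E (Num.sqrt N).
  have r20 : 0 <= 2 * Num.sqrt N by rewrite mulr_ge0// ltW.
  rewrite /E sqr_sqrtr ?(ltW N0)// subrr mul0r subr0; apply: mulr_ge0.
    by rewrite ltW// !mulr_gt0.
  exact: le_trans (cosh_ge1 r20).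
have [v /andP[tv _] Ev] : exists2 v, t <= v <= Num.sqrt N & E v = 0.
  by apply: continuous_root; [exact: cE|exact: ltW|right; rewrite Et EN].
exists v; first exact: lt_le_trans tv.
by apply/eqP; rewrite -subr_eq0; apply/eqP.
Qed.

(** Now sigma N is the product of N - v^2 and tanh(2v) / v, both positive and decreasing at the
    roots considered. *)
Lemma hyp_root_le sigma N v v' : 0 < sigma -> 0 < N -> 0 < v -> 0 < v' ->
  hyp_root sigma N v -> hyp_root sigma N v' -> v' <= v.
Proof.
move=> s0 N0 v0 v'0 e e'; rewrite leNgt; apply/negP => vv'.
have [_ _ Nv] := hyp_root_bounds s0 N0 v0 e.
have [_ _ Nv'] := hyp_root_bounds s0 N0 v'0 e'.
have v20 : 0 < 2 * v by lra.
have v20' : 0 < 2 * v' by lra.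
have Ch : 0 < cosh (2 * v) by apply: lt_le_trans (cosh_ge1 (ltW v20)).
have Ch' : 0 < cosh (2 * v') by apply: lt_le_trans (cosh_ge1 (ltW v20')).
have vv2 : 2 * v < 2 * v' by lra.
have sec := tanh_secant_lt v20 vv2.
have T'0 : 0 < sinh (2 * v') / cosh (2 * v') by rewrite divr_gt0// sinh_gt0.
have eT : sigma * N * v = (N - v ^+ 2) * (sinh (2 * v) / cosh (2 * v)).
  by apply: (mulIf (lt0r_neq0 Ch)); rewrite e -mulrA divfK// gt_eqF.
have eT' : sigma * N * v' = (N - v' ^+ 2) * (sinh (2 * v') / cosh (2 * v')).
  by apply: (mulIf (lt0r_neq0 Ch')); rewrite e' -mulrA divfK// gt_eqF.
move: eT eT' T'0 sec.
move: (sinh (2 * v) / _) (sinh (2 * v') / _) => T T' eT eT' T'0 sec.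
have : v * T' * (N - v' ^+ 2) < v' * T * (N - v ^+ 2).
  apply: ltr_pM.
  - by rewrite mulr_ge0 ?ltW.
  - by rewrite subr_ge0 ltW.
  - by rewrite -(ltr_pM2l (ltr0Sn R 1)); lra.
  - by rewrite ltrD2l ltrN2 ltr_pXn2r// nnegrE ltW.
have -> : v' * T * (N - v ^+ 2) = v' * (sigma * N * v) by rewrite eT; ring.
have -> : v * T' * (N - v' ^+ 2) = v * (sigma * N * v') by rewrite eT'; ring.
by rewrite (_ : v' * _ = v * (sigma * N * v')) ?ltxx//; ring.
Qed.

End CharacteristicEquations.

(** * The spectrum *)

Section Spectrum.
Set Implicit Arguments.
Unset Strict Implicit.
Context {R : realType}.
Implicit Types (sigma w v z : R) (n : int) (k : nat).

Lemma fundamental_pair_osc w : w != 0 ->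
  fundamental_pair (- w ^+ 2) (fun x => w^-1 * sin (w * (x + 1))) (fun x => cos (w * (x + 1))).
Proof.
move=> w0; split => [x|x||].
- apply: (is_derive_eq (is_derive_scale w^-1 (is_derive_affine (is_derive_sin _)))).
  by rewrite mulKf.
- apply: (is_derive_eq (is_derive_affine (is_derive_cos _))).
  by field.
- by rewrite addNr mulr0 sin0 mulr0.
- by rewrite addNr mulr0 cos0.
Qed.

Lemma fundamental_pair_lin : fundamental_pair (0 : R) (fun x => x + 1) (fun=> 1).
Proof.
split => [x|x||]; rewrite ?addNr//.
- rewrite -[X in is_derive _ _ _ X]addr0.
  exact: (@is_derive_add R id (cst 1) x 1 0 (is_derive_id x 1) (is_derive_cst _ x 1)).
- by rewrite mul0r; exact: (is_derive_cst (1 : R) x 1).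
Qed.

Lemma fundamental_pair_hyp v : v != 0 ->
  fundamental_pair (v ^+ 2) (fun x => v^-1 * sinh (v * (x + 1))) (fun x => cosh (v * (x + 1))).
Proof.
move=> v0; split => [x|x||].
- apply: (is_derive_eq (is_derive_scale v^-1 (is_derive_affine (is_derive_sinh _)))).
  by rewrite mulKf.
- apply: (is_derive_eq (is_derive_affine (is_derive_cosh _))).
  by field.
- by rewrite addNr mulr0 sinh0 mulr0.
- by rewrite addNr mulr0 cosh0.
Qed.

Lemma osc_eigenvalueP sigma n w : 0 < sigma -> n != 0 -> 0 < w ->
  eigenvalues sigma n (- w ^+ 2 - n%:~R ^+ 2) <-> osc_root sigma (n%:~R ^+ 2) w.
Proof.
move=> s0 n0 w0; have wn0 : w != 0 by rewrite gt_eqF.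
have := fundamental_pair_osc wn0; rewrite -{1}[- w ^+ 2](subrK (n%:~R ^+ 2)).
move=> /(eigenvaluesP s0 n0) ->; rewrite (_ : w * (1 + 1) = 2 * w); last by ring.
rewrite /osc_root.
have key : w * (sigma * n%:~R ^+ 2 * cos (2 * w) +
    (- w ^+ 2 - n%:~R ^+ 2) * (w^-1 * sin (2 * w))) =
  sigma * n%:~R ^+ 2 * w * cos (2 * w) - (n%:~R ^+ 2 + w ^+ 2) * sin (2 * w) by field.
split=> [e|/eqP]; last rewrite -subr_eq0 -key mulf_eq0 (negbTE wn0) => /eqP//.
by apply/eqP; rewrite -subr_eq0 -key e mulr0.
Qed.

Lemma lin_eigenvalueP sigma n : 0 < sigma -> n != 0 ->
  eigenvalues sigma n (- n%:~R ^+ 2) <-> sigma = 2.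
Proof.
move=> s0 n0; have := fundamental_pair_lin; rewrite -{1}(addNr (n%:~R ^+ 2)).
move=> /(eigenvaluesP s0 n0) ->.
have nn0 : n%:~R ^+ 2 != 0 :> R by rewrite sqrf_eq0 intr_eq0.
have -> : sigma * n%:~R ^+ 2 * 1 + - n%:~R ^+ 2 * (1 + 1) = n%:~R ^+ 2 * (sigma - 2).
  by ring.
split=> [/eqP|->]; last by rewrite subrr mulr0.
by rewrite mulf_eq0 (negbTE nn0) subr_eq0 => /eqP.
Qed.

Lemma hyp_eigenvalueP sigma n v : 0 < sigma -> n != 0 -> 0 < v ->
  eigenvalues sigma n (v ^+ 2 - n%:~R ^+ 2) <-> hyp_root sigma (n%:~R ^+ 2) v.
Proof.
move=> s0 n0 v0; have vn0 : v != 0 by rewrite gt_eqF.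
have := fundamental_pair_hyp vn0; rewrite -{1}[v ^+ 2](subrK (n%:~R ^+ 2)).
move=> /(eigenvaluesP s0 n0) ->; rewrite (_ : v * (1 + 1) = 2 * v); last by ring.
rewrite /hyp_root.
have key : v * (sigma * n%:~R ^+ 2 * cosh (2 * v) +
    (v ^+ 2 - n%:~R ^+ 2) * (v^-1 * sinh (2 * v))) =
  sigma * n%:~R ^+ 2 * v * cosh (2 * v) - (n%:~R ^+ 2 - v ^+ 2) * sinh (2 * v) by field.
split=> [e|/eqP]; last rewrite -subr_eq0 -key mulf_eq0 (negbTE vn0) => /eqP//.
by apply/eqP; rewrite -subr_eq0 -key e mulr0.
Qed.

(** The index is that of the branch of tan, so existence and uniqueness are settled branch by
    branch. For k = 0 the comparison of sigma with 2 opens exactly one case. *)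
Variant spectral_value sigma n k z : Prop :=
| SpectralOsc t of (0 < k)%N \/ 2 < sigma & 0 < t < pi / 4 &
    osc_root sigma (n%:~R ^+ 2) (k%:R * pi / 2 + t) &
    z = - (k%:R * pi / 2 + t) ^+ 2 - n%:~R ^+ 2
| SpectralLin of k = 0%N & sigma = 2 & z = - n%:~R ^+ 2
| SpectralHyp v of k = 0%N & sigma < 2 & 0 < v & hyp_root sigma (n%:~R ^+ 2) v &
    z = v ^+ 2 - n%:~R ^+ 2.

Lemma halfpi_nat_ge0 k : 0 <= k%:R * pi / 2 :> R.
Proof. by rewrite !mulr_ge0 ?invr_ge0// ltW// pi_gt0. Qed.

Lemma sqr_int_gt0 n : n != 0 -> 0 < n%:~R ^+ 2 :> R.
Proof. by move=> n0; rewrite exprn_even_gt0// intr_eq0. Qed.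

Lemma eigenvalues_spectral sigma n z : 0 < sigma -> n != 0 ->
  eigenvalues sigma n z <-> exists k, spectral_value sigma n k z.
Proof.
move=> s0 n0; have N0 := sqr_int_gt0 n0; split; last first.
  move=> [k [t hk /andP[t0 _] e ->|k0 s2 ->|v k0 s2 v0 e ->]].
  - by apply/osc_eigenvalueP => //; rewrite ltr_wpDl// halfpi_nat_ge0.
  - exact/lin_eigenvalueP.
  - exact/hyp_eigenvalueP.
have [m0|m0|m0] := ltgtP (z + n%:~R ^+ 2) 0.
- pose w := Num.sqrt (- (z + n%:~R ^+ 2)).
  have w0 : 0 < w by rewrite sqrtr_gt0 oppr_gt0.
  have zE : z = - w ^+ 2 - n%:~R ^+ 2.
    by rewrite sqr_sqrtr ?oppr_ge0 ?(ltW m0)//; ring.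
  rewrite zE => /(osc_eigenvalueP s0 n0 w0) e.
  have [k [t tI [wE hk]]] := osc_root_location s0 N0 w0 e.
  by exists k; apply: (@SpectralOsc _ _ _ _ t); rewrite // -wE.
- pose v := Num.sqrt (z + n%:~R ^+ 2).
  have v0 : 0 < v by rewrite sqrtr_gt0.
  have zE : z = v ^+ 2 - n%:~R ^+ 2.
    by rewrite sqr_sqrtr ?(ltW m0)//; ring.
  rewrite zE => /(hyp_eigenvalueP s0 n0 v0) e.
  have [s2 _ _] := hyp_root_bounds s0 N0 v0 e.
  by exists 0%N; apply: (@SpectralHyp _ _ _ _ v).
- have zE : z = - n%:~R ^+ 2 by apply/eqP; rewrite -addr_eq0; apply/eqP.
  rewrite zE => /(lin_eigenvalueP s0 n0) s2.
  by exists 0%N; apply: SpectralLin.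
Qed.

Lemma spectral_value_exists sigma n k : 0 < sigma -> n != 0 ->
  exists z, spectral_value sigma n k z.
Proof.
move=> s0 n0; have N0 := sqr_int_gt0 n0.
have osc : (0 < k)%N \/ 2 < sigma -> exists z, spectral_value sigma n k z.
  move=> hk; have [t tI e] := osc_root_exists s0 N0 hk.
  by eexists; apply: (@SpectralOsc _ _ _ _ t).
have [k0|k0] := posnP k; last by apply: osc; left.
have [s2|s2|s2] := ltgtP sigma 2; last 2 first.
- by apply: osc; right.
- by eexists; apply: SpectralLin.
have [v v0 e] := hyp_root_exists s0 s2 N0.
by eexists; apply: (@SpectralHyp _ _ _ _ v).
Qed.

Lemma spectral_value_inj sigma n k z z' : 0 < sigma -> n != 0 ->
  spectral_value sigma n k z -> spectral_value sigma n k z' -> z = z'.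
Proof.
move=> s0 n0; have N0 := sqr_int_gt0 n0.
move=> [t hk tI e ->|k0 s2 ->|v k0 s2 v0 e ->] [t' hk' tI' e' ->|k0' s2' ->|v' k0' s2' v0' e' ->] //.
- suff -> : t = t' by [].
  by apply/eqP; rewrite eq_le !(@osc_root_le _ sigma (n%:~R ^+ 2) k).
- by case: hk; rewrite ?k0'// s2' ltxx.
- by case: hk; rewrite ?k0'// ltNge (ltW s2').
- by case: hk'; rewrite ?k0// s2 ltxx.
- by move: s2'; rewrite s2 ltxx.
- by case: hk'; rewrite ?k0// ltNge (ltW s2).
- by move: s2; rewrite s2' ltxx.
- suff -> : v = v' by [].
  by apply/eqP; rewrite eq_le !(@hyp_root_le _ sigma (n%:~R ^+ 2)).
Qed.

Lemma spectral_value_bounds sigma n k z : 0 < sigma -> n != 0 ->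
  spectral_value sigma n k z ->
  (0 < k)%N \/ 2 < sigma ->
  exists2 w, k%:R * pi / 2 < w < k%:R * pi / 2 + pi / 4 & z = - w ^+ 2 - n%:~R ^+ 2.
Proof.
move=> s0 n0 [t hk /andP[t0 tpi] e ->|-> -> _|v -> s2 _ _ _].
- by move=> _; exists (k%:R * pi / 2 + t) => //; rewrite ltrDl t0 ltrD2l.
- by case; rewrite ?ltxx.
- by case; rewrite // ltNge (ltW s2).
Qed.

(** The next frequency is at least (k + 1) pi / 2 and the present one at most k pi / 2 + pi / 4, so
    the squares differ by at least 3 pi^2 / 16. A linear or hyperbolic value at k = 0 is at least -
    n^2, which leaves pi^2 / 4. *)
Lemma spectral_value_gap sigma n k z z' : 0 < sigma -> n != 0 ->
  spectral_value sigma n k z -> spectral_value sigma n k.+1 z' ->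
  z' + pi ^+ 2 / 8 <= z.
Proof.
move=> s0 n0 hz hz'; have pi0 := @pi_gt0 R.
have [] := spectral_value_bounds s0 n0 hz' (or_introl (ltn0Sn k)).
rewrite -[k.+1%:R]natr1 => w' /andP[w'1 _] ->.
have c0 := halfpi_nat_ge0 k.
have w'2 : (k%:R * pi / 2 + pi / 2) ^+ 2 <= w' ^+ 2.
  by rewrite ler_pXn2r ?nnegrE//; lra.
case: hz => [t hk /andP[t0 tpi] e ->|k0 _ ->|v k0 _ _ _ ->].
- have w2 : (k%:R * pi / 2 + t) ^+ 2 <= (k%:R * pi / 2 + pi / 4) ^+ 2.
    by rewrite ler_pXn2r ?nnegrE//; lra.
  have c1 : 0 <= (k%:R * pi / 2) * pi :> R by rewrite mulr_ge0// ltW.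
  have p2 := sqr_ge0 (pi : R).
  by lra.
- by move: w'2; rewrite k0 !mul0r add0r; have := sqr_ge0 (pi : R); lra.
- by move: w'2; rewrite k0 !mul0r add0r; have := sqr_ge0 (pi : R); have := sqr_ge0 v; lra.
Qed.

(** By the gap, branch number and rank in the decreasing order agree. *)
Lemma spectral_sequence_exists sigma n : 0 < sigma -> n != 0 ->
  exists2 l : nat -> R, eigenvalue_sequence sigma n l &
    forall k, spectral_value sigma n k (l k).
Proof.
move=> s0 n0; have [l lP] := choice (fun k => spectral_value_exists k s0 n0).
exists l => //; split.
  apply/decreasing_seqP => k; have := spectral_value_gap s0 n0 (lP k) (lP k.+1).
  by apply: lt_le_trans; rewrite ltrDl divr_gt0// exprn_gt0// pi_gt0.
apply/seteqP; split => [_ [k _ <-]|z].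
  by apply/eigenvalues_spectral => //; exists k.
move=> /(eigenvalues_spectral _ s0 n0)[k hz]; exists k => //.
exact: spectral_value_inj (lP k) hz.
Qed.

Lemma spectral_value_lt0 sigma n k z : 0 < sigma -> n != 0 ->
  spectral_value sigma n k z -> z < 0.
Proof.
move=> s0 n0; have N0 := sqr_int_gt0 n0.
move=> [t _ _ _ ->|_ _ ->|v _ _ v0 e ->].
- by rewrite -opprD oppr_lt0 ltr_wpDl// sqr_ge0.
- by rewrite oppr_lt0.
- by have [_ _] := hyp_root_bounds s0 N0 v0 e; rewrite subr_lt0.
Qed.

End Spectrum.

(** * Lower bounds on subintervals *)

Section Observability.
Set Implicit Arguments.
Unset Strict Implicit.
Context {R : realType}.
Local Notation mu := (@lebesgue_measure R).
Implicit Types (sigma w v z a B q c d L : R) (n : int) (k : nat) (phi S : R -> R).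

Lemma subset_oo_bounds c d : c < d -> `]c, d[%classic `<=` (`]-1, 1[%classic : set R) ->
  -1 <= c /\ d <= 1.
Proof.
move=> cd sub; split; rewrite leNgt; apply/negP => out.
- pose x := (c + Num.min d (-1)) / 2.
  have m1 : c < Num.min d (-1) by rewrite lt_min cd.
  have m2 : Num.min d (-1) <= d by rewrite ge_min lexx.
  have m3 : Num.min d (-1) <= -1 by rewrite ge_min lexx orbT.
  have /sub/= : `]c, d[%classic x by rewrite /= in_itv/= /x; apply/andP; split; lra.
  by rewrite in_itv/= /x => /andP[]; lra.
- pose x := (d + Num.max c 1) / 2.
  have m1 : Num.max c 1 < d by rewrite gt_max cd.
  have m2 : c <= Num.max c 1 by rewrite le_max lexx.
  have m3 : 1 <= Num.max c 1 by rewrite le_max lexx orbT.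
  have /sub/= : `]c, d[%classic x by rewrite /= in_itv/= /x; apply/andP; split; lra.
  by rewrite in_itv/= /x => /andP[]; lra.
Qed.

Lemma Rintegral_cst_oo B c d : c < d -> \int[mu]_(x in `]c, d[) B = B * (d - c).
Proof.
by move=> cd; rewrite Rintegral_cst//= lebesgue_measure_itv/= lte_fin cd -EFinD.
Qed.

Lemma sqr_int_ge1 n : n != 0 -> 1 <= n%:~R ^+ 2 :> R.
Proof.
move=> n0; rewrite -rmorphXn /= ler1z.
by have : 0 < n ^+ 2 by rewrite exprn_even_gt0.
Qed.

Lemma continuous_sqr (f : R -> R) : continuous f -> continuous (fun x => f x ^+ 2).
Proof.
move=> cf x; rewrite /continuous_at expr2; under [X in X @ _]eq_fun do rewrite expr2.
by apply: cvgM; exact: cf.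
Qed.

(* The normalization forces a^2 B (2 + 1 / sigma) >= 1. *)
Lemma L2norm_on_ge sigma n phi S a B q c d :
  0 < sigma -> n != 0 -> continuous S -> {in `[-1, 1], forall x, phi x = a * S x} ->
  0 < B -> {in `[-1, 1], forall x, S x ^+ 2 <= B} ->
  c < d -> `]c, d[%classic `<=` (`]-1, 1[%classic : set R) ->
  0 <= q -> q * B <= \int[mu]_(x in `]c, d[) (S x ^+ 2) ->
  Hnorm sigma n (phi, - (1 / (sigma * n%:~R ^+ 2)) * phi 1) = 1 ->
  Num.sqrt (q / (2 + 1 / sigma)) <= L2norm_on c d phi.
Proof.
move=> s0 n0 cS phiS B0 SB cd sub q0 qB norm1.
have N1 := sqr_int_ge1 n0; have N0 : 0 < n%:~R ^+ 2 :> R by exact: sqr_int_gt0.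
have lt11 : -1 < 1 :> R by lra.
have cS2 : continuous (fun x => S x ^+ 2).
  exact: continuous_sqr.
have iS2 e f : mu.-integrable `]e, f[ (EFin \o (fun x => S x ^+ 2)).
  exact/integrable_oo_continuous/within_continuous.
have oneI : (1 : R) \in `[-1, 1] by rewrite in_itv/=; lra.
have intphi e f : `]e, f[%classic `<=` (`]-1, 1[%classic : set R) ->
    \int[mu]_(x in `]e, f[) (phi x ^+ 2) = a ^+ 2 * \int[mu]_(x in `]e, f[) (S x ^+ 2).
  move=> sub'; rewrite -RintegralZl//; apply: eq_Rintegral => x; rewrite inE => xef.
  by rewrite phiS ?exprMn//; apply/subset_itv_oo_cc/sub'.
have hdot : Hdot sigma n (phi, - (1 / (sigma * n%:~R ^+ 2)) * phi 1)
    (phi, - (1 / (sigma * n%:~R ^+ 2)) * phi 1) =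
    a ^+ 2 * (\int[mu]_(x in `]-1, 1[) (S x ^+ 2) + S 1 ^+ 2 / (sigma * n%:~R ^+ 2)).
  rewrite /Hdot /L2dot/=.
  have -> : \int[mu]_(x in `]-1, 1[) (phi x * phi x) = \int[mu]_(x in `]-1, 1[) (phi x ^+ 2).
    by apply: eq_Rintegral => x _; rewrite expr2.
  rewrite intphi// phiS// mulrDr; congr (_ + _).
  by field; rewrite (gt_eqF s0) /= -sqrf_eq0 (gt_eqF N0).
have aB : 1 <= a ^+ 2 * (B * (2 + 1 / sigma)).
  have h0 : 0 <= a ^+ 2 * (\int[mu]_(x in `]-1, 1[) (S x ^+ 2) + S 1 ^+ 2 / (sigma * n%:~R ^+ 2)).
    rewrite mulr_ge0 ?sqr_ge0// addr_ge0//.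
      by apply: Rintegral_ge0 => x _; exact: sqr_ge0.
    by rewrite divr_ge0 ?sqr_ge0// mulr_ge0// ltW.
  move: norm1; rewrite /Hnorm hdot => /(congr1 (fun x => x ^+ 2)).
  rewrite sqr_sqrtr// expr1n => e; rewrite -[leLHS]e ler_wpM2l ?sqr_ge0// mulrDr lerD//.
    rewrite (_ : B * 2 = \int[mu]_(x in `]-1, 1[) B); last by rewrite Rintegral_cst_oo//; ring.
    apply: le_Rintegral => //.
      by apply/integrable_oo_continuous/within_continuous => x; exact: cvg_cst.
    by move=> x /= xI; apply/SB/subset_itv_oo_cc.
  rewrite ler_pM ?sqr_ge0 ?SB//; first by rewrite invr_ge0 mulr_ge0// ltW.
  (* Here n leaves the estimate: as n^2 >= 1, the boundary term is at most B / sigma. *)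
  have sn : sigma <= sigma * n%:~R ^+ 2 by rewrite ler_peMr// ltW.
  by rewrite div1r lef_pV2// posrE mulr_gt0.
rewrite /L2norm_on ler_wsqrtr// intphi//.
have K0 : 0 < 2 + 1 / sigma by rewrite addr_gt0// divr_gt0.
(* Only the ratio q of local mass to squared supremum bound remains; the amplitude and B cancel. *)
rewrite ler_pdivrMr//; apply: (@le_trans _ _ (a ^+ 2 * (q * B) * (2 + 1 / sigma))).
  rewrite (_ : _ * _ * _ = q * (a ^+ 2 * (B * (2 + 1 / sigma)))); last by ring.
  by rewrite ler_peMr.
by rewrite ler_wpM2r ?(ltW K0)// ler_wpM2l ?sqr_ge0.
Qed.

Lemma Rintegral_sin_sqr w c d : w != 0 -> c < d ->
  \int[mu]_(x in `]c, d[) (sin (w * (x + 1)) ^+ 2) =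
  (d - c) / 2 - (sin (2 * w * (d + 1)) - sin (2 * w * (c + 1))) / (4 * w).
Proof.
move=> w0 cd.
pose F x := 2^-1 * x - (4 * w)^-1 * sin (2 * w * (x + 1)).
have dF (x : R) : is_derive x 1 F (sin (w * (x + 1)) ^+ 2).
  apply: (is_derive_eq (is_derive_sub (is_derive_scale 2^-1 (is_derive_id x 1))
    (is_derive_scale (4 * w)^-1 (is_derive_affine (is_derive_sin _))))).
  rewrite (_ : 2 * w * (x + 1) = (w * (x + 1)) *+ 2); last by ring.
  by rewrite cos_mulr2n cos2sin2; field.
rewrite (@Rintegral_FTC2 _ _ F)//.
- by rewrite /F; field.
- apply: within_continuous; apply: (@derive_continuous _ _
    (fun x => (w * cos (w * (x + 1))) * sin (w * (x + 1)) + sin (w * (x + 1)) * (w * cos (w * (x + 1))))).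
  move=> x; under eq_fun do rewrite expr2.
  exact: is_derive_mul (is_derive_affine (is_derive_sin _)) (is_derive_affine (is_derive_sin _)).
- exact/within_continuous/derive_continuous.
Qed.

(** This removes w from the size of the integral. If w L >= 2, the sine term is at most 1 / w <= L /
    2. Otherwise 1 / w > L / 2, and monotonicity of t - |sin t| replaces w L by L. *)
Lemma mul_sub_norm_sin_le w L : 1 <= w -> 0 < L -> L <= 2 ->
  L * (L - `|sin L|) / 4 <= L - `|sin (w * L)| / w.
Proof.
move=> w1 L0 L2; have w0 : 0 < w by lra.
have sL := norm_sin_lt L0; have sL0 := normr_ge0 (sin L).
have [wL|wL] := lerP 2 (w * L).
  have h1 : `|sin (w * L)| / w <= L / 2.
    by rewrite ler_pdivrMr//; have := sin_max (w * L); lra.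
  have : L * (L - `|sin L|) <= L * 2 by rewrite ler_wpM2l//; lra.
  by lra.
have LwL : L <= w * L by rewrite ler_peMl// ltW.
have h := sub_norm_sin_homo LwL.
rewrite (_ : L - `|sin (w * L)| / w = (w * L - `|sin (w * L)|) / w); last by field; rewrite gt_eqF.
rewrite ler_pdivlMr//; apply: le_trans h.
rewrite (_ : L * _ / 4 * w = (w * L / 4) * (L - `|sin L|)); last by ring.
rewrite ler_piMl ?subr_ge0 ?ltW//; lra.
Qed.

Lemma osc_observability w c d : 1 <= w -> c < d -> d - c <= 2 ->
  (d - c) * ((d - c) - `|sin (d - c)|) / 8 * w^-1 ^+ 2 <=
  \int[mu]_(x in `]c, d[) ((w^-1 * sin (w * (x + 1))) ^+ 2).
Proof.
move=> w1 cd L2; have w0 : 0 < w by lra.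
have csin : continuous (fun x : R => sin (w * (x + 1)) ^+ 2).
  apply: continuous_sqr.
  exact: (derive_continuous (fun x => is_derive_affine (is_derive_sin (w * (x + 1))))).
under eq_Rintegral do rewrite exprMn.
rewrite RintegralZl//; last exact/integrable_oo_continuous/within_continuous.
rewrite mulrC ler_wpM2l ?sqr_ge0// Rintegral_sin_sqr ?gt_eqF//.
have L0 : 0 < d - c by lra.
have := mul_sub_norm_sin_le w1 L0 L2.
rewrite (_ : 2 * w * (d + 1) = w * (d + c + 2) + w * (d - c)); last by ring.
rewrite (_ : 2 * w * (c + 1) = w * (d + c + 2) - w * (d - c)); last by ring.
(* The difference of sines becomes 2 cos A sin T: the position of the interval enters only through
   cos A, bounded by 1. *)
rewrite [sin (_ + w * (d - c))]sinD [sin (_ - w * (d - c))]sinB; set A := w * (d + c + 2); set T := w * (d - c).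
have : cos A * sin T <= `|sin T|.
  apply: le_trans (ler_norm _) _; rewrite normrM ler_piMl// cos_max//.
move=> h1 h2; have h3 : cos A * sin T / w <= `|sin T| / w by rewrite ler_pM2r ?invr_gt0.
rewrite (_ : _ / (4 * w) = cos A * sin T / w / 2); last by field; rewrite gt_eqF.
by lra.
Qed.

(** For fixed length the worst interval starts at -1: q^3 - p^3 - (q - p)^3 = 3 p q (q - p) with p =
    c + 1 and q = d + 1. *)
Lemma Rintegral_shift_sqr_ge c d : -1 <= c -> c < d ->
  (d - c) ^+ 3 / 3 <= \int[mu]_(x in `]c, d[) ((x + 1) ^+ 2).
Proof.
move=> c1 cd; have d1 (x : R) : is_derive x 1 (fun x : R => x + 1) 1.
  by have [] := @fundamental_pair_lin R.
have d2 (x : R) : is_derive x 1 (fun x : R => (x + 1) ^+ 2) (2 * (x + 1)).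
  under eq_fun do rewrite expr2.
  apply: (is_derive_eq (is_derive_mul (d1 x) (d1 x))); ring.
have d3 (x : R) : is_derive x 1 (fun x : R => 3^-1 * (x + 1) ^+ 3) ((x + 1) ^+ 2).
  under eq_fun do rewrite exprS.
  by apply: (is_derive_eq (is_derive_scale _ (is_derive_mul (d1 x) (d2 x)))); field.
rewrite (@Rintegral_FTC2 _ _ (fun x : R => 3^-1 * (x + 1) ^+ 3))//.
- have : 0 <= 3 * (d - c) * (c + 1) * (d + 1) by rewrite !mulr_ge0//; lra.
  by lra.
- exact/within_continuous/derive_continuous.
- exact/within_continuous/derive_continuous.
Qed.

Lemma ground_observability S B c d : continuous S -> 0 < B -> c < d ->
  `]c, d[%classic `<=` (`]-1, 1[%classic : set R) ->
  {in `[-1, 1], forall x, (x + 1) / 2 <= S x} ->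
  (d - c) ^+ 3 / (12 * B) * B <= \int[mu]_(x in `]c, d[) (S x ^+ 2).
Proof.
move=> cS B0 cd sub Sge; have [c1 _] := subset_oo_bounds cd sub.
rewrite (_ : _ * B = 4^-1 * ((d - c) ^+ 3 / 3)); last by field; rewrite gt_eqF.
apply: (@le_trans _ _ (4^-1 * \int[mu]_(x in `]c, d[) ((x + 1) ^+ 2))).
  by rewrite ler_wpM2l// Rintegral_shift_sqr_ge.
have cont : continuous (fun x : R => (x + 1) ^+ 2).
  by apply: continuous_sqr => x; apply: cvgD; [exact: cvg_id|exact: cvg_cst].
rewrite -RintegralZl//; last exact/integrable_oo_continuous/within_continuous.
apply: le_Rintegral => //.
- apply/integrable_oo_continuous/within_continuous => x; apply: cvgM; [exact: cvg_cst|exact: cont].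
- exact: (integrable_oo_continuous (within_continuous (continuous_sqr cS))).
- move=> x xcd; have xI : x \in `[-1, 1] by exact: subset_itv_oo_cc (sub _ xcd).
  have x1 : 0 <= (x + 1) / 2 by move: xI; rewrite in_itv/= => /andP[? _]; lra.
  rewrite (_ : 4^-1 * _ = ((x + 1) / 2) ^+ 2); last by field.
  by rewrite ler_pXn2r ?nnegrE// ?Sge// (le_trans x1)// Sge.
Qed.

End Observability.

(** * Uniform lower bound for normalized eigenfunctions *)

Section EigenfunctionLowerBound.
Set Implicit Arguments.
Unset Strict Implicit.
Context {R : realType}.
Implicit Types (sigma w v z c d L t : R) (n : int) (k : nat) (phi S : R -> R).

(** By half angles, sin t = 2 sin(t/2) cos(t/2) >= t cos(t/2)^2 = (t / 2)(1 + cos t). *)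
Lemma half_le_sin t : 0 <= t -> t <= pi / 2 -> t / 2 <= sin t.
Proof.
rewrite le_eqVlt => /predU1P[<- _|t0 tpi]; first by rewrite sin0 mul0r.
have h : t / 2 * cos (t / 2) < sin (t / 2) by apply: mul_cos_lt_sin; lra.
have ct2 : 0 < cos (t / 2) by apply: cos_gt0_pihalf; lra.
have ct : 0 <= cos t by apply: cos_ge0_pihalf; lra.
have e : t / 2 *+ 2 = t by field.
have sE : sin t = 2 * (sin (t / 2) * cos (t / 2)).
  by rewrite -[in LHS]e sin_mulr2n; ring.
have cE : cos t = 2 * cos (t / 2) ^+ 2 - 1.
  by rewrite -[in LHS]e cos_mulr2n; ring.
have h2 : t / 2 * cos (t / 2) * cos (t / 2) <= sin (t / 2) * cos (t / 2).
  by rewrite ler_wpM2r// ltW.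
have h3 : 0 <= t / 2 * cos t by rewrite mulr_ge0//; lra.
rewrite sE; apply: (@le_trans _ _ (t / 2 + t / 2 * cos t)); first lra.
by rewrite cE; lra.
Qed.

(** Both bounds are free of n. The lower one uses t (x + 1) <= pi / 2 in the oscillating case. The
    upper one is 2 in the first two cases, and in the third sinh(2v) / v < 2 cosh(2v) with v < 1 /
    sigma. *)
Lemma ground_pair sigma n z : 0 < sigma -> n != 0 -> spectral_value sigma n 0 z ->
  exists S C, fundamental_pair (z + n%:~R ^+ 2) S C /\
    {in `[-1, 1], forall x, (x + 1) / 2 <= S x /\ S x <= 2 * cosh (2 / sigma)}.
Proof.
move=> s0 n0; have ch1 : 1 <= cosh (2 / sigma) by rewrite cosh_ge1// divr_ge0// ltW.
move=> [t _ /andP[t0 tpi] _ ->|_ _ ->|v _ s2 v0 e ->].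
- rewrite !mul0r add0r subrK; exists (fun x => t^-1 * sin (t * (x + 1))), (fun x => cos (t * (x + 1))).
  split; first by apply: fundamental_pair_osc; rewrite gt_eqF.
  move=> x; rewrite in_itv/= => /andP[x1 x2]; rewrite ![t^-1 * _]mulrC.
  have tx0 : 0 <= t * (x + 1) by apply: mulr_ge0; [exact: ltW|lra].
  have tx2 : t * (x + 1) <= t * 2 by rewrite ler_pM2l//; lra.
  split.
    rewrite ler_pdivlMr// (_ : _ * t = t * (x + 1) / 2); last by ring.
    by apply: half_le_sin => //; lra.
  rewrite ler_pdivrMr//.
  have : sin (t * (x + 1)) <= t * (x + 1).
    by move: tx0; rewrite le_eqVlt => /predU1P[<-|/sin_lt/ltW//]; rewrite sin0.
  have : 1 * t <= cosh (2 / sigma) * t by rewrite ler_pM2r.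
  by lra.
- rewrite addNr; exists (fun x => x + 1), (fun=> 1); split; first exact: fundamental_pair_lin.
  by move=> x; rewrite in_itv/= => /andP[x1 x2]; split; lra.
- have [_ vs _] := hyp_root_bounds s0 (sqr_int_gt0 n0) v0 e.
  rewrite subrK; exists (fun x => v^-1 * sinh (v * (x + 1))), (fun x => cosh (v * (x + 1))).
  split; first by apply: fundamental_pair_hyp; rewrite gt_eqF.
  move=> x; rewrite in_itv/= => /andP[x1 x2]; rewrite ![v^-1 * _]mulrC.
  have vx0 : 0 <= v * (x + 1) by apply: mulr_ge0; [exact: ltW|lra].
  split.
    rewrite ler_pdivlMr//.
    have : v * (x + 1) <= sinh (v * (x + 1)).
      by move: vx0; rewrite le_eqVlt => /predU1P[<-|/lt_sinh/ltW//]; rewrite sinh0.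
    by lra.
  rewrite ler_pdivrMr//.
  have sh2 : sinh (v * (x + 1)) <= sinh (2 * v).
    have : v * (x + 1) <= 2 * v by rewrite mulrC ler_pM2r//; lra.
    by rewrite le_eqVlt => /predU1P[->//|/sinh_lt/ltW].
  have v20 : 0 < 2 * v by lra.
  have v2s : 2 * v < 2 / sigma by lra.
  have h1 := sinh_lt_mul_cosh v20; have h2 := cosh_lt (ltW v20) v2s.
  have h3 : 2 * v * cosh (2 * v) <= 2 * v * cosh (2 / sigma) by rewrite ler_pM2l// ltW.
  by lra.
Qed.

(** The minimum is over the two ratios of local mass to squared supremum bound, for k > 0 and for k
    = 0; 2 + 1 / sigma is the cost of the normalization, 2 being the length of (-1, 1). *)
Definition observability_constant sigma L : R :=
  Num.sqrt (Num.min (L * (L - `|sin L|) / 8) (L ^+ 3 / (12 * (2 * cosh (2 / sigma)) ^+ 2)) /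
    (2 + 1 / sigma)).

Lemma observability_constant_gt0 sigma L : 0 < sigma -> 0 < L ->
  0 < observability_constant sigma L.
Proof.
move=> s0 L0; have ch1 : 1 <= cosh (2 / sigma) by rewrite cosh_ge1// divr_ge0// ltW.
rewrite sqrtr_gt0 divr_gt0//; last by rewrite addr_gt0// divr_gt0.
rewrite lt_min !divr_gt0//; first by rewrite exprn_gt0.
  by rewrite mulr_gt0// exprn_gt0//; lra.
by rewrite mulr_gt0// subr_gt0 norm_sin_lt.
Qed.

Lemma eigenfunction_observability sigma n k z phi c d :
  0 < sigma -> n != 0 -> spectral_value sigma n k z ->
  c < d -> `]c, d[%classic `<=` (`]-1, 1[%classic : set R) ->
  let Phi := (phi, - (1 / (sigma * n%:~R ^+ 2)) * phi 1) in
  Hnorm sigma n Phi = 1 -> eigenfunction sigma n z Phi ->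
  observability_constant sigma (d - c) <= L2norm_on c d phi.
Proof.
move=> s0 n0 hz cd sub Phi norm1 [_ graph].
have [c1 d1] := subset_oo_bounds cd sub.
have L0 : 0 < d - c by rewrite subr_gt0.
have L2 : d - c <= 2 by lra.
have ch1 : 1 <= cosh (2 / sigma) by rewrite cosh_ge1// divr_ge0// ltW.
have K0 : 0 <= (2 + 1 / sigma)^-1 by rewrite invr_ge0 addr_ge0// divr_ge0// ltW.
have [k0|k0] := posnP k.
  rewrite k0 in hz; have [S [C [SC Sb]]] := ground_pair s0 n0 hz.
  have [a [phiS _ _]] := A_graph_eigen_solution SC graph.
  have cS : continuous S by case: SC => dS _ _ _; exact: derive_continuous dS.
  have B0 : 0 < (2 * cosh (2 / sigma)) ^+ 2 by rewrite exprn_gt0//; lra.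
  have Sge : {in `[-1, 1], forall x, (x + 1) / 2 <= S x} by move=> x /Sb[].
  apply: le_trans (L2norm_on_ge s0 n0 cS phiS B0 _ cd sub _
    (ground_observability cS B0 cd sub Sge) norm1).
  - by rewrite ler_wsqrtr// ler_wpM2r// ge_min lexx orbT.
  - move=> x xI; have [Sx1 Sx2] := Sb x xI.
    have Sx0 : 0 <= S x by move: xI; rewrite in_itv/= => /andP[? _]; lra.
    by rewrite ler_pXn2r ?nnegrE// (le_trans Sx0).
  - by rewrite divr_ge0 ?exprn_ge0 ?mulr_ge0// ltW.
have [w /andP[w1 _] zE] := spectral_value_bounds s0 n0 hz (or_introl k0).
have {}w1 : 1 <= w.
  have p2 := @pi_ge2 R; apply: le_trans (ltW w1).
  have : 1 * 2 <= k%:R * pi :> R by rewrite ler_pM// ler1n.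
  by lra.
have w0 : 0 < w by lra.
have wn0 : w != 0 by rewrite gt_eqF.
have SC := fundamental_pair_osc wn0.
rewrite -[- w ^+ 2](subrK (n%:~R ^+ 2)) -zE in SC.
have [a [phiS _ _]] := A_graph_eigen_solution SC graph.
have cS : continuous (fun x : R => w^-1 * sin (w * (x + 1))).
  by case: SC => dS _ _ _; exact: derive_continuous dS.
have B0 : 0 < w^-1 ^+ 2 by rewrite exprn_gt0// invr_gt0.
apply: le_trans (L2norm_on_ge s0 n0 cS phiS B0 _ cd sub _
  (osc_observability w1 cd L2) norm1).
- by rewrite ler_wsqrtr// ler_wpM2r// ge_min lexx.
- by move=> x _; rewrite exprMn ler_piMr ?sqr_ge0// sin2cos2 gerBl sqr_ge0.
- by rewrite divr_ge0// mulr_ge0 ?ltW// subr_gt0 norm_sin_lt.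
Qed.

End EigenfunctionLowerBound.

(** For sigma > 2 the oscillating family starts at k = 0, with a root in (0, pi / 4), so the phase
    is k pi / 2 rather than (k + 1) pi / 2. *)
Theorem lemma4p2 (R : realType) :
  exists2 r : R, 0 < r & forall sigma : R, 0 < sigma ->
  exists lambda : int -> nat -> R,
    (forall n : int, n != 0 ->
       [/\ eigenvalue_sequence sigma n (lambda n),
           forall k : nat, lambda n k < 0,
           2 < sigma ->
             exists eps : nat -> R,
               (forall k : nat, 0 < eps k < pi / 4) /\
               (forall k : nat, lambda n k =
                  - (k%:R * pi / 2 + pi / 4 - eps k) ^+ 2 - n%:~R ^+ 2)
         & sigma <= 2 ->
             [/\ exists eps : nat -> R,
                   (forall k : nat, 0 < eps k < pi / 4) /\
                   (forall k : nat, (1 <= k)%N -> lambda n k =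
                      - (k%:R * pi / 2 + pi / 4 - eps k) ^+ 2 - n%:~R ^+ 2),
                 sigma < 2 ->
                   exists nu0 : R, 0 < nu0 < 1 / sigma /\
                     lambda n 0%N = nu0 ^+ 2 - n%:~R ^+ 2
               & sigma = 2 -> lambda n 0%N = - n%:~R ^+ 2]]) /\
    [/\ exists2 gamma : R, 0 < gamma & forall n : int, n != 0 ->
          gamma < inf (range (fun k : nat => `|lambda n k.+1 - lambda n k|)),
        forall n : int, n != 0 ->
          (fun k : nat =>
             - lambda n k - (r * k%:R ^+ 2 + n%:~R ^+ 2) : R^o)
            =O_\oo (fun k : nat => k%:R : R^o)
      & exists C : R -> R, forall c d : R, c < d ->
          `]c, d[%classic `<=` (`]-1, 1[%classic : set R) ->
          0 < C (c - d) /\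
          forall (n : int) (k : nat) (phi : R -> R), n != 0 ->
            let Phi := (phi, - (1 / (sigma * n%:~R ^+ 2)) * phi 1) in
            Hnorm sigma n Phi = 1 ->
            eigenfunction sigma n (lambda n k) Phi ->
            C (c - d) <= L2norm_on c d phi].
Proof.
have pi0 := @pi_gt0 R; have pi20 : 0 < pi ^+ 2 :> R by rewrite exprn_gt0.
(* The square of the spacing pi / 2 between branches. *)
exists (pi ^+ 2 / 4); first by rewrite divr_gt0.
move=> sigma s0.
have sequence n : exists l, n != 0 ->
    eigenvalue_sequence sigma n l /\ forall k, spectral_value sigma n k (l k).
  (* A default sequence at n = 0 makes the choice total in n. *)
  have [_|n0] := eqVneq n 0; first by exists (fun=> 0).
  by have [l hl lP] := spectral_sequence_exists s0 n0; exists l.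
have [lambda lambdaP] := choice sequence.
exists lambda; split.
  move=> n n0; have [lseq lP] := lambdaP n n0.
  have epsP k : exists e : R, 0 < e < pi / 4 /\ ((0 < k)%N \/ 2 < sigma ->
      lambda n k = - (k%:R * pi / 2 + pi / 4 - e) ^+ 2 - n%:~R ^+ 2).
    have [hk|hk] := pselect ((0 < k)%N \/ 2 < sigma); last first.
      (* A default inside (0, pi / 4), for k = 0 and sigma <= 2. *)
      by exists (pi / 8); split => //; apply/andP; split; lra.
    have [w /andP[w1 w2] ->] := spectral_value_bounds s0 n0 (lP k) hk.
    exists (k%:R * pi / 2 + pi / 4 - w); split; first by apply/andP; split; lra.
    by move=> _; congr (- _ ^+ 2 - _); ring.
  have [eps epsE] := choice epsP.
  split => //.
  - by move=> k; exact: spectral_value_lt0 (lP k).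
  - move=> s2; exists eps; split => k; first by have [] := epsE k.
    by have [_] := epsE k; apply; right.
  - move=> s2; split.
    + exists eps; split => k; first by have [] := epsE k.
      by move=> k0; have [_] := epsE k; apply; left.
    + move=> s2'; case: (lP 0%N) => [t [//|]|_ s2E|v _ _ v0 e ->].
      * by rewrite ltNge s2.
      * by move: s2'; rewrite s2E ltxx.
      * by exists v; have [_ -> _] := hyp_root_bounds s0 (sqr_int_gt0 n0) v0 e; rewrite v0.
    + move=> s2E; case: (lP 0%N) => [t [//|]|_ _ ->//|v _ s2']; first by rewrite s2E ltxx.
      by move: s2'; rewrite s2E ltxx.
split.
(* Half of the proved gap: the infimum must exceed gamma strictly. *)
- exists (pi ^+ 2 / 16); first by rewrite divr_gt0.
  move=> n n0; have [_ lP] := lambdaP n n0.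
  apply: (@lt_le_trans _ _ (pi ^+ 2 / 8)); first by lra.
  apply: lb_le_inf; first by exists `|lambda n 1%N - lambda n 0%N|, 0%N.
  move=> _ [k _ <-]; have gap := spectral_value_gap s0 n0 (lP k) (lP k.+1).
  by rewrite distrC; apply: le_trans (ler_norm _); lra.
- move=> n n0; have [_ lP] := lambdaP n n0.
  (* The remainder w^2 - (k pi / 2)^2 lies between 0 and k pi^2 / 4 + pi^2 / 16, which is below pi^2
     k once k >= 1. *)
  apply/eqO_exP; exists (pi ^+ 2) => //; near=> k.
  have k0 : (0 < k)%N by near: k; exact: nbhs_infty_gt.
  have k1 : 1 <= k%:R :> R by rewrite ler1n.
  have [w /andP[w1 w2] ->] := spectral_value_bounds s0 n0 (lP k) (or_introl k0).
  have c0 := @halfpi_nat_ge0 R k.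
  have h1 : (k%:R * pi / 2) ^+ 2 <= w ^+ 2 by rewrite ler_pXn2r ?nnegrE//; lra.
  have h2 : w ^+ 2 <= (k%:R * pi / 2 + pi / 4) ^+ 2 by rewrite ler_pXn2r ?nnegrE//; lra.
  have h3 : pi ^+ 2 * 1 <= pi ^+ 2 * k%:R :> R by rewrite ler_pM2l.
  rewrite (ger0_norm (ler0n _ k)) ger0_norm; first lra.
  lra.
(* C is evaluated at c - d < 0, hence the change of sign. *)
- exists (fun l => observability_constant sigma (- l)) => c d cd sub.
  rewrite opprB; split; first by apply: observability_constant_gt0; rewrite ?subr_gt0.
  move=> n k phi n0 Phi norm1 eig; have [_ lP] := lambdaP n n0.
  exact: eigenfunction_observability s0 n0 (lP k) cd sub norm1 eig.
Unshelve. all: by end_near. Qed.
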